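(* Let $\mathcal{M}$ be a $t\times u$ matrix whose entries $\mathcal{M}_{k,\ell}$ ($1\le k\le t$, $1\le \ell\le u$) are permutation classes, each of which has a proper growth rate, and let $\Gamma$ be the $t\times u$ real matrix with $\Gamma_{k,\ell}=\sqrt{\mathrm{gr}(\mathcal{M}_{k,\ell})}$. Then the proper growth rate of $\operatorname{Grid}(\mathcal{M})$ exists and is equal to the greatest eigenvalue of $\Gamma^T\Gamma$ (equivalently, of $\Gamma\Gamma^T$).
   Context: A permutation of length $n$ is a bijection of $\{1,\dots,n\}$, written as $\pi(1)\cdots\pi(n)$. Two sequences of distinct reals $a(1),\dots,a(k)$ and $b(1),\dots,b(k)$ are order isomorphic if $a(i)<a(j)\iff b(i)<b(j)$ for all $i,j$. A permutation $\pi$ contains $\sigma$ if some subsequence of $\pi$ is order isomorphic to $\sigma$. A permutation class is a set of permutations closed downward under containment. For a class $\mathcal{C}$, $\mathcal{C}_n$ is the set of its permutations of length $n$, and the proper growth rate is $\mathrm{gr}(\mathcal{C})=\lim_{n\to\infty}|\mathcal{C}_n|^{1/n}$ when this limit exists (the empty class has growth rate $0$). For a $t\times u$ matrix $\mathcal{M}$ of permutation classes (indexed Cartesian-style: $\mathcal{M}_{k,\ell}$ is in the $k$-th column from the left and $\ell$-th row from the bottom), an $\mathcal{M}$-gridding of a permutation $\pi$ of length $n$ is a pair of sequences $1=c_1\le\cdots\le c_{t+1}=n+1$ and $1=r_1\le\cdots\le r_{u+1}=n+1$ such that for all $k,\ell$, the entries $\pi(i)$ with $i\in[c_k,c_{k+1})$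 and $\pi(i)\in[r_\ell,r_{\ell+1})$ form a sequence order isomorphic to a permutation in $\mathcal{M}_{k,\ell}$. The grid class $\operatorname{Grid}(\mathcal{M})$ is the set of all permutations having an $\mathcal{M}$-gridding.
   Formalization: In a gridding, a cell containing no entries is always allowed, even when its class is the empty class; read literally, one empty class in M would make Grid(M) empty and the claim false (e.g. entries ∅ and Av(21)). The matrix is assumed to have t, u ≥ 1. *)

(* Defs.v *)
From HB Require Import structures.
From mathcomp Require Import all_boot all_order all_fingroup all_algebra.
From mathcomp Require Import all_classical all_reals all_analysis.
Set Implicit Arguments.
Unset Strict Implicit.
Unset Printing Implicit Defensive.
Import Order.TTheory GRing.Theory Num.Theory.
Import numFieldNormedType.Exports.
Local Open Scope ring_scope.

Definition one_line (n : nat) (p : 'S_n) : seq nat :=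
  [seq val (p i) | i <- enum 'I_n].

Definition order_iso (a b : seq nat) : Prop :=
  size a = size b /\
  forall i j : nat, (i < size a)%N -> (j < size a)%N ->
    (nth 0%N a i < nth 0%N a j)%N = (nth 0%N b i < nth 0%N b j)%N.

Definition contains (n m : nat) (p : 'S_n) (s : 'S_m) : Prop :=
  exists2 w : seq nat, subseq w (one_line p) & order_iso w (one_line s).

(* C n is the set of the members of C of length n. *)
Definition perm_set : Type := forall n : nat, {set 'S_n}.

Definition perm_class (C : perm_set) : Prop :=
  forall (n m : nat) (p : 'S_n) (s : 'S_m),
    contains p s -> p \in C n -> s \in C m.

(* The value at n = 0 is 1, which does not affect the limit. *)
Definition growth_seq (R : realType) (C : perm_set) (n : nat) : R :=
  (#|C n|%:R : R) `^ (n%:R^-1).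

Definition has_growth_rate (R : realType) (C : perm_set) : Prop :=
  cvg (growth_seq R C @ \oo)%classic.

Definition gr (R : realType) (C : perm_set) : R :=
  lim (growth_seq R C @ \oo)%classic.

(* Positions and values are numbered from 0, so c k and r l stand for the
   1-based c_(k+1) - 1 and r_(l+1) - 1. *)
Definition cell (n : nat) (p : 'S_n) (c r : nat -> nat) (k l : nat) : seq nat :=
  [seq val (p i) | i : 'I_n <- enum 'I_n &
     (c k <= i < c k.+1)%N && (r l <= p i < r l.+1)%N].

(* An empty cell is always allowed: this matters only when M k l has no member
   at all, since a nonempty class contains the permutation of length 0. *)
Definition is_gridding (t u : nat) (M : 'M[perm_set]_(t, u)) (n : nat)
    (p : 'S_n) (c r : nat -> nat) : Prop :=
  [/\ c 0%N = 0%N /\ c t = n,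
      r 0%N = 0%N /\ r u = n,
      forall k : nat, (k < t)%N -> (c k <= c k.+1)%N,
      forall l : nat, (l < u)%N -> (r l <= r l.+1)%N
    & forall (k : 'I_t) (l : 'I_u),
        cell p c r k l = [::] \/
        exists (m : nat) (s : 'S_m),
          s \in M k l m /\ order_iso (cell p c r k l) (one_line s)].

Definition Grid (t u : nat) (M : 'M[perm_set]_(t, u)) : perm_set :=
  fun n => [set p : 'S_n | `[< exists c r : nat -> nat, is_gridding M p c r >]].

Definition growth_matrix (R : realType) (t u : nat) (M : 'M[perm_set]_(t, u)) :
    'M[R]_(t, u) :=
  \matrix_(k, l) Num.sqrt (gr R (M k l)).

Definition greatest_eigenvalue (R : realType) (n : nat) (A : 'M[R]_n) (a : R) :
    Prop :=
  eigenvalue A a /\ forall b : R, eigenvalue A b -> b <= a.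

(* Main.v *)
(** A permutation p gridded by labels col of its positions and row of its values
    is the same thing as a pair of words over the set of cells (the cell of each
    position, the cell of each value) with the same content, together with a
    member of the class of each cell of the right length.

    Let v be a unit top eigenvector of Gamma^T Gamma, lam its eigenvalue and
    w = Gamma v.  Upper bound: weight position i in the cell (k, l) by
    Gamma_kl v_l / w_k and value j in the cell (k, l) by Gamma_kl w_k / v_l.  The
    factors v and w cancel because the two words have the same content, so the
    number of gridded permutations is at most the sum over all pairs of words,
    which factors as 1 ^ n * lam ^ n.  (A small perturbation makes Gamma, and
    hence v and w, positive.)  Lower bound: words over the cells with letter
    weights Gamma_kl w_k v_l have total weight lam ^ n, and there are only
    polynomially many contents, so some content a has weight at least
    lam ^ n / poly(n).  Squaring, and bounding the weights of the two marginals
    of a by those of all words over the columns and over the rows, turns this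
    into a lower bound for the number of permutations gridded with content a. *)

Require Import Defs.
From HB Require Import structures.
From mathcomp Require Import all_boot all_order all_fingroup all_algebra.
From mathcomp Require Import all_classical all_reals all_analysis.
From mathcomp Require Import ring lra.
Import Order.TTheory GRing.Theory Num.Theory.
Import numFieldNormedType.Exports.
Local Open Scope ring_scope.

Set Implicit Arguments.
Unset Strict Implicit.
Unset Printing Implicit Defensive.

(** * Permutations with prescribed labels and cell patterns *)

Lemma size_one_line (m : nat) (s : 'S_m) : size (one_line s) = m.
Proof. by rewrite size_map size_enum_ord. Qed.

Lemma nth_one_line (m : nat) (s : 'S_m) (i : 'I_m) :
  nth 0%N (one_line s) i = s i.
Proof. by rewrite (nth_map i) ?size_enum_ord// nth_ord_enum. Qed.

Lemma nth_one_line_lt (m : nat) (s : 'S_m) (q : nat) :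
  (q < m)%N -> (nth 0%N (one_line s) q < m)%N.
Proof. by move=> qm; rewrite (nth_one_line s (Ordinal qm)). Qed.

Lemma nth_one_line_inj (m : nat) (s : 'S_m) (q q' : nat) :
  (q < m)%N -> (q' < m)%N ->
  nth 0%N (one_line s) q = nth 0%N (one_line s) q' -> q = q'.
Proof.
move=> qm q'm.
rewrite (nth_one_line s (Ordinal qm)) (nth_one_line s (Ordinal q'm)).
by move=> /val_inj/perm_inj [].
Qed.

Lemma order_iso_sym (a b : seq nat) : order_iso a b -> order_iso b a.
Proof. by case=> e h; split=> // i j ib jb; rewrite h// e. Qed.

Lemma order_iso_trans (a b c : seq nat) :
  order_iso a b -> order_iso b c -> order_iso a c.
Proof.
move=> [e h] [e' h']; split; first by rewrite e.
by move=> i j ia ja; rewrite h// h' -?e.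
Qed.

Lemma order_iso_perm_class (C : perm_set) (m m' : nat) (s : 'S_m) (s' : 'S_m') :
  perm_class C -> order_iso (one_line s) (one_line s') ->
  s \in C m -> s' \in C m'.
Proof. by move=> CC ss'; apply: CC; exists (one_line s). Qed.

Definition all_perms : perm_set := fun m => [set: 'S_m].

Lemma all_perms_class : perm_class all_perms.
Proof. by move=> n m p s _ _; rewrite inE. Qed.

Section Words.
Context {n : nat} {K : finType}.
Implicit Types (al be : 'I_n -> K) (p : 'S_n) (C : K -> perm_set).

Definition occ al (k : K) : seq 'I_n := [seq i <- enum 'I_n | al i == k].

Definition cnt al (k : K) : nat := size (occ al k).

Definition block al p (k : K) : seq nat := [seq val (p i) | i <- occ al k].

Definition patt_in (C : perm_set) (w : seq nat) : Prop :=
  exists (m : nat) (s : 'S_m), s \in C m /\ order_iso w (one_line s).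

Lemma eq_block al be p : al =1 be -> block al p =1 block be p.
Proof. by move=> e k; congr map; apply: eq_filter => i; rewrite e. Qed.

Lemma mem_occ al k i : (i \in occ al k) = (al i == k).
Proof. by rewrite mem_filter mem_enum andbT. Qed.

Lemma uniq_occ al k : uniq (occ al k).
Proof. by rewrite filter_uniq// enum_uniq. Qed.

Lemma cntE al k : cnt al k = #|[pred i | al i == k]|.
Proof. by rewrite cardE /cnt /occ enumT /enum_mem !size_filter. Qed.

Lemma index_occ_lt al i : (index i (occ al (al i)) < cnt al (al i))%N.
Proof. by rewrite index_mem mem_occ. Qed.

Lemma cnt_le al k : (cnt al k <= n)%N.
Proof.
by rewrite /cnt size_filter (leq_trans (count_size _ _))// size_enum_ord.
Qed.

(** [occ] filters an increasing enumeration, so comparing two of its entries amounts to comparing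
    their ranks. This is what lets [block_glue] transfer order. *)
Lemma occ_nth_lt be k i0 (a b : nat) : (a < cnt be k)%N -> (b < cnt be k)%N ->
  (nth i0 (occ be k) a < nth i0 (occ be k) b)%N = (a < b)%N.
Proof.
have srt : sorted ltn (map val (occ be k)).
  have -> : map val (occ be k) =
     [seq j <- iota 0 n | (nth k (map be (enum 'I_n)) j) == k].
    rewrite -val_enum_ord filter_map; congr map; apply: eq_filter => i /=.
    by rewrite (nth_map i) ?size_enum_ord// nth_ord_enum.
  by rewrite sorted_filter ?iota_ltn_sorted//; exact: ltn_trans.
have mono a' b' : (a' < b')%N -> (b' < cnt be k)%N ->
    (nth i0 (occ be k) a' < nth i0 (occ be k) b')%N.
  move=> ab bk; have ak := ltn_trans ab bk.
  have := @sorted_ltn_nth _ ltn ltn_trans 0%N _ srt a' b'.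
  by rewrite !inE size_map !(nth_map i0)//; apply.
move=> ak bk; case: (ltngtP a b) => [ab|ab|->]; last by rewrite ltnn.
  by rewrite mono.
by apply/negbTE; rewrite -leqNgt ltnW// mono.
Qed.

Section Glue.
Variables (al be : 'I_n -> K).
Hypothesis eq_cnt : cnt al =1 cnt be.

Let T (k : K) : finType := 'S_(cnt al k).

(* Sends the q-th position with label k to the (s k q)-th value with label k. *)
Definition glue_fun (s : {dffun forall k, T k}) (i : 'I_n) : 'I_n :=
  nth i (occ be (al i))
    (nth 0%N (one_line (s (al i))) (index i (occ al (al i)))).

Lemma glue_rank_lt (s : {dffun forall k, T k}) i :
  (nth 0%N (one_line (s (al i))) (index i (occ al (al i))) <
     size (occ be (al i)))%N.
Proof. by rewrite -[size _]eq_cnt nth_one_line_lt// index_occ_lt. Qed.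

Lemma glue_label s i : be (glue_fun s i) = al i.
Proof.
have : glue_fun s i \in occ be (al i) by rewrite mem_nth// glue_rank_lt.
by rewrite mem_occ => /eqP.
Qed.

Lemma glue_inj s : injective (glue_fun s).
Proof.
move=> i j eij; have eal : al i = al j by rewrite -!(glue_label s) eij.
(* [glue_fun] uses its own argument as the default of [nth]; the ranks are in range, so one default
   can be used on both sides. *)
move: eij; rewrite /glue_fun (set_nth_default i j) ?glue_rank_lt//.
move: (glue_rank_lt s i) (glue_rank_lt s j).
move: (index_occ_lt al i) (index_occ_lt al j); rewrite -!eal => ii ij ri rj.
move/eqP; rewrite nth_uniq ?uniq_occ// => /eqP/nth_one_line_inj => /(_ ii ij) e.
have := nth_index i (_ : i \in occ al (al i)).
rewrite mem_occ eqxx => /(_ isT) <-; rewrite e nth_index//.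
by rewrite mem_occ eal.
Qed.

Definition glue s : 'S_n := perm (@glue_inj s).

Lemma block_glue s k : order_iso (block al (glue s) k) (one_line (s k)).
Proof.
split; first by rewrite size_map size_one_line.
rewrite size_map => a b ak bk.
have i0 : 'I_n by move: ak; case: (occ al k).
have nthb c : (c < size (occ al k))%N -> nth 0%N (block al (glue s) k) c =
     val (nth i0 (occ be k) (nth 0%N (one_line (s k)) c)).
  move=> ck; rewrite (nth_map i0)// permE.
  set i := nth i0 _ _; have ik : al i = k by apply/eqP; rewrite -mem_occ mem_nth.
  have ic : index i (occ al k) = c by rewrite index_uniq// uniq_occ.
  rewrite -ic -ik /glue_fun; congr val; apply: set_nth_default.
  exact: glue_rank_lt.
rewrite !nthb// occ_nth_lt//.
  by rewrite -eq_cnt nth_one_line_lt.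
by rewrite -eq_cnt nth_one_line_lt.
Qed.

Lemma glue_injective : injective glue.
Proof.
move=> s s' e; apply/ffunP => k; apply/permP => q; apply/val_inj => /=.
have i0 : 'I_n by move: q; rewrite /cnt; case: (occ al k) => [[]|].
set i := nth i0 (occ al k) q.
have ik : al i = k by apply/eqP; rewrite -mem_occ mem_nth// ltn_ord.
have ic : index i (occ al k) = q by rewrite index_uniq ?uniq_occ// ltn_ord.
have /permP/(_ i) := e; rewrite !permE /glue_fun.
move: (glue_rank_lt s i) (glue_rank_lt s' i); rewrite !ik !ic !nth_one_line.
by move=> h h' /eqP; rewrite nth_uniq ?uniq_occ// => /eqP.
Qed.

(** Let [s k] send the rank of a position among those labelled [k] to the rank of its value among
    the values labelled [k]. *)
Lemma exists_glue p : (forall i, be (p i) = al i) -> exists s, p = glue s.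
Proof.
move=> pl.
have : forall k, exists s : 'S_(cnt al k), forall i, al i = k ->
    nth 0%N (one_line s) (index i (occ al k)) = index (p i) (occ be k).
  move=> k; have [i0 _|noi] := pickP (@predT 'I_n); last first.
    by exists 1%g => i; have := noi i.
  have lt (q : 'I_(cnt al k)) :
      (index (p (nth i0 (occ al k) q)) (occ be k) < cnt al k)%N.
    rewrite (leq_trans _ (eq_leq (esym (eq_cnt k))))// index_mem mem_occ pl.
    by rewrite -mem_occ mem_nth//; exact: ltn_ord.
  have inj : injective (fun q => Ordinal (lt q)).
    move=> q q' [] /eqP; have mem (r : 'I_(cnt al k)) :
        p (nth i0 (occ al k) r) \in occ be k.
      by rewrite mem_occ pl -mem_occ mem_nth//; exact: ltn_ord.
    move=> /eqP /(congr1 (nth i0 (occ be k))); rewrite !nth_index//.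
    by move=> /perm_inj/eqP; rewrite nth_uniq ?uniq_occ// => /eqP/val_inj.
  exists (perm inj) => i ik.
  have ilt : (index i (occ al k) < cnt al k)%N by rewrite -ik index_occ_lt.
  rewrite (nth_one_line _ (Ordinal ilt)) permE /= nth_index//.
  by rewrite mem_occ ik.
move=> /fin_all_exists [s sP].
exists [ffun k => s k : T k]; apply/permP => i; rewrite permE /glue_fun ffunE sP//.
by rewrite nth_index// mem_occ pl.
Qed.

(** [glue] is a bijection from families of cell permutations onto the permutations that respect the
    labels, and by [block_glue] the pattern in cell [k] is [s k]; the conditions on the cells are
    therefore independent. *)
Lemma card_glue C : (forall k, perm_class (C k)) ->
  #|[set p : 'S_n | [forall i, be (p i) == al i] &&
       `[< forall k, patt_in (C k) (block al p k) >]]| =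
  (\prod_k #|C k (cnt al k)|)%N.
Proof.
move=> clC; rewrite -(@cardsXn K T (fun k => C k (cnt al k))).
rewrite -(card_imset _ glue_injective); apply: eq_card => p.
apply/idP/imsetP.
  rewrite inE => /andP[/forallP pl /asboolP pC].
  have [s ps] := exists_glue (fun i => eqP (pl i)).
  exists s => //; rewrite in_setXn; apply/forallP => k.
  (* The witness [s'] has its own length [m]; closure under order isomorphism moves the membership
     to [s k]. *)
  have [m [s' [s'C os']]] := pC k; apply: order_iso_perm_class s'C => //.
  apply: order_iso_trans (order_iso_sym os') _; rewrite ps. exact: block_glue.
move=> [s]; rewrite in_setXn => /forallP sC ->; rewrite inE.
apply/andP; split; first by apply/forallP => i; rewrite permE glue_label.
apply/asboolP => k; exists (cnt al k), (s k); split; [exact: sC|exact: block_glue].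
Qed.

End Glue.

Lemma eq_cnt_perm al be p : (forall i, be (p i) = al i) -> cnt al =1 cnt be.
Proof.
move=> pl k; rewrite !cntE -(fintype.card_image (@perm_inj _ p)); apply: eq_card => j.
apply/fintype.imageP/idP => [[i]|]; first by rewrite !inE => /eqP <- ->; rewrite pl.
by rewrite !inE => jk; exists (p^-1%g j); rewrite ?inE -?pl permKV.
Qed.

Definition same_cnt al be : bool := [forall k, cnt al k == cnt be k].

Lemma card_perm_labels al be C : (forall k, perm_class (C k)) ->
  #|[set p : 'S_n | [forall i, be (p i) == al i] &&
       `[< forall k, patt_in (C k) (block al p k) >]]| =
  (same_cnt al be * \prod_k #|C k (cnt al k)|)%N.
Proof.
move=> clC; have [/forallP e|ne] := boolP (same_cnt al be).
  by rewrite mul1n card_glue// => k; apply/eqP.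
rewrite mul0n; apply: eq_card0 => p; rewrite !inE; apply/negP => /andP[/forallP].
move=> pl _; case/negP: ne; apply/forallP => k; apply/eqP/(@eq_cnt_perm _ _ p).
by move=> i; apply/eqP.
Qed.


Lemma card_perm_words al be :
  #|[set p : 'S_n | [forall i, be (p i) == al i]]| =
  (same_cnt al be * \prod_k (cnt al k)`!)%N.
Proof.
have := @card_perm_labels al be (fun=> all_perms) (fun=> all_perms_class).
under [in X in _ = X -> _]eq_bigr do rewrite cardsT card_Sn.
move=> <-; apply: eq_card => p; rewrite !inE; case: forallP => //= pl.
apply/esym/asboolP => k; have pl' i : be (p i) = al i by apply/eqP.
have [s ->] := exists_glue (eq_cnt_perm pl') pl'.
by exists (cnt al k), (s k); split; [rewrite inE|exact: block_glue].
Qed.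

End Words.

(** * Counting words by content *)

Section WordCounts.
Context {n : nat}.

Lemma same_cnt_refl (K : finType) (al : 'I_n -> K) : same_cnt al al.
Proof. by apply/forallP. Qed.

(* Both sides count the permutations p with pi (al (p i)) = pi (al i) for all i,
   the left one according to the word al o p. *)
Lemma card_words_over (K T : finType) (pi : K -> T) (al : 'I_n -> K) :
  (#|[set x : {ffun 'I_n -> K} | same_cnt x al &&
        [forall i, pi (x i) == pi (al i)]]| * \prod_k (cnt al k)`! =
   \prod_t (cnt (pi \o al) t)`!)%N.
Proof.
have := card_perm_words (pi \o al) (pi \o al).
rewrite same_cnt_refl mul1n => <-; rewrite -[RHS]sum1_card.
rewrite (partition_big (fun p : 'S_n => [ffun i => al (p i)])
  (fun x : {ffun 'I_n -> K} => [forall i, pi (x i) == pi (al i)])) /=; last first.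
  by move=> p; rewrite inE => /forallP h; apply/forallP => i; rewrite ffunE h.
rewrite -sum1_card big_distrl /=
  [RHS](bigID (fun x : {ffun 'I_n -> K} => same_cnt x al)) /=.
rewrite [X in (_ = _ + X)%N]big1 ?addn0.
  apply: eq_big => [x|x]; first by rewrite inE andbC.
  rewrite inE => /andP[xal /forallP xpi]; rewrite mul1n.
  (* Each word [x] with the content of [al] is [al] composed with exactly the product of the
     [(cnt al k)!] many permutations. *)
  have := card_perm_words x al; rewrite xal mul1n.
  under eq_bigr do rewrite (eqP (forallP xal _)).
  move=> <-; rewrite -sum1_card; apply: eq_bigl => p; rewrite !inE.
  apply/forallP/andP => [h|[_ /eqP <-] i]; last by rewrite ffunE.
  split; first by apply/forallP => i /=; rewrite (eqP (h i)) xpi.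
  by apply/eqP/ffunP => i; rewrite ffunE; exact/eqP.
move=> x /andP[_ /negbTE xal]; have := card_perm_words x al.
rewrite xal mul0n => /eqP; rewrite cards_eq0 => /eqP/setP e.
apply: big1 => p /andP[_ /eqP px]; have := e p; rewrite !inE => /forallP; case.
by move=> i; rewrite -px ffunE.
Qed.

(** The multinomial coefficient: [card_words_over] with [pi] constant. *)
Lemma card_words (K : finType) (al : 'I_n -> K) :
  (#|[set x : {ffun 'I_n -> K} | same_cnt x al]| * \prod_k (cnt al k)`! = n`!)%N.
Proof.
have := card_words_over (fun=> tt) al.
rewrite (big_pred1 tt) => [|[]//]; rewrite cntE.
rewrite [in X in _ = X -> _](@eq_card _ _ 'I_n) ?card_ord// => <-.
congr (_ * _)%N; apply: eq_card => x; rewrite !inE.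
by case: same_cnt => //=; apply/esym/forallP.
Qed.

End WordCounts.

(** * Permutations gridded by fixed, possibly non-monotone labels *)

Section LabelGriddings.
Context {n : nat} {T U : finType}.
Variables (col : 'I_n -> T) (row : 'I_n -> U) (C : T * U -> perm_set).
Hypothesis clC : forall k, perm_class (C k).

Definition label_gridded : {set 'S_n} := [set p : 'S_n |
  `[< forall k, patt_in (C k) (block (fun i => (col i, row (p i))) p k) >]].

Definition col_words : {set {ffun 'I_n -> T * U}} :=
  [set x : {ffun 'I_n -> T * U} | [forall i, (x i).1 == col i]].

Definition row_words : {set {ffun 'I_n -> T * U}} :=
  [set y : {ffun 'I_n -> T * U} | [forall j, (y j).2 == row j]].

(** Classify [p] by the word [x] of the cells of its positions, whose columns are prescribed, and
    the word [y] of the cells of its values, whose rows are prescribed. For given [x] and [y],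
    [card_perm_labels] counts the permutations. *)
Lemma card_label_gridded :
  #|label_gridded| = (\sum_(x in col_words) \sum_(y in row_words)
     same_cnt x y * \prod_k #|C k (cnt x k)|)%N.
Proof.
rewrite -sum1_card.
rewrite (partition_big (fun p : 'S_n => [ffun i => (col i, row (p i))])
  (mem col_words)) /=; last first.
  by move=> p _; rewrite inE; apply/forallP => i; rewrite ffunE.
apply: eq_bigr => x; rewrite inE => /forallP xc.
rewrite (partition_big (fun p : 'S_n => [ffun j => (col (p^-1%g j), row j)])
  (mem row_words)) /=; last first.
  by move=> p _; rewrite inE; apply/forallP => i; rewrite ffunE.
apply: eq_bigr => y; rewrite inE => /forallP yr.
rewrite -card_perm_labels// -sum1_card; apply: eq_bigl => p; rewrite !inE.
apply/andP/andP => [[/andP[/asboolP pC /eqP px] /eqP py]|[/forallP yx /asboolP pC]].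
  split; first by apply/forallP => i; rewrite -px -py !ffunE permK.
  apply/asboolP => k; rewrite (@eq_block _ _ _ (fun i => (col i, row (p i)))) //.
  by move=> i; rewrite -px ffunE.
(* The column of [x i] is known from [x], and its row from [y (p i) = x i]. *)
have px : x = [ffun i => (col i, row (p i))].
  apply/ffunP => i; rewrite ffunE; apply/eqP; rewrite -pair_eqE /= xc.
  by rewrite -(eqP (yx i)) yr.
split; first (apply/andP; split; last exact/eqP).
  apply/asboolP => k; rewrite (@eq_block _ _ _ x) // => i.
  by rewrite px ffunE.
apply/eqP/ffunP => j; rewrite ffunE; apply/eqP; rewrite eq_sym -pair_eqE /= yr.
by rewrite -{1}(permKV p j) (eqP (yx _)) xc.
Qed.

End LabelGriddings.

(** * Griddings and monotone labels *)

(* Adds the permutation of length 0, since Grid always allows an empty cell. *)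
Definition pad (C : perm_set) : perm_set :=
  fun m => if m == 0%N then [set: 'S_m] else C m.

Lemma perm_class_pad (C : perm_set) : perm_class C -> perm_class (pad C).
Proof.
move=> CC m m' p s ps; rewrite /pad.
case: (eqVneq m' 0%N) => [|m'0]; first by rewrite inE.
case: (eqVneq m 0%N) => [m0|_]; last exact: CC ps.
case: ps => w /size_subseq ws [sw _]; case/negP: m'0; rewrite -leqn0.
by rewrite -[X in (_ <= X)%N]m0 -(size_one_line p) -(size_one_line s) -sw.
Qed.

Lemma patt_in_pad (C : perm_set) (w : seq nat) :
  patt_in (pad C) w <->
  w = [::] \/ exists (m : nat) (s : 'S_m), s \in C m /\ order_iso w (one_line s).
Proof.
split=> [[m [s []]]|[->|[m [s [sC os]]]]].
- rewrite /pad; case: eqVneq => [m0 _ [sw _]|_ sC os]; last first.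
    by right; exists m, s.
  by left; apply/size0nil; rewrite sw size_one_line.
- exists 0%N, 1%g; split; first by rewrite inE.
  by split=> //; rewrite size_one_line.
- by exists m, s; split=> //; rewrite /pad; case: eqVneq => // _; rewrite inE.
Qed.

Section MonotoneLabels.
Context {n t : nat}.
Implicit Type col : 'I_n -> 'I_t.

(** For monotone [col] this is the first position after all labels below [k], hence the divider of a
    gridding. *)
Definition cuts col (k : nat) : nat := #|[set i | (col i < k)%N]|.

Lemma cuts0 col : cuts col 0 = 0%N.
Proof. by apply: eq_card0 => i; rewrite inE. Qed.

Lemma cutst col : cuts col t = n.
Proof.
by rewrite /cuts -[RHS]card_ord; apply: eq_card => i; rewrite !inE ltn_ord.
Qed.

Lemma cuts_le col k : (cuts col k <= cuts col k.+1)%N.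
Proof. by apply/subset_leq_card/fintype.subsetP => i; rewrite !inE; exact: leqW. Qed.

Lemma cutsP col : {homo col : i j / (i <= j)%N} ->
  forall (i : 'I_n) (k : 'I_t), (cuts col k <= i < cuts col k.+1)%N = (col i == k).
Proof.
move=> mono i.
have card_below (j : 'I_n) : #|[set i' : 'I_n | (i' < j)%N]| = j.
  have inj : injective (widen_ord (ltnW (ltn_ord j))) by move=> a b [] /val_inj.
  rewrite -[RHS]card_ord -(fintype.card_image inj).
  apply: eq_card => i'; rewrite inE; apply/idP/fintype.imageP => [ij|[x _ ->]] /=.
    by exists (Ordinal ij) => //; exact/val_inj.
  exact: ltn_ord.
have lt_cuts k : (i < cuts col k)%N = (col i < k)%N.
  apply/idP/idP => [|ik]; last first.
    rewrite /cuts (cardsD1 i) inE ik add1n ltnS -{1}(card_below i).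
    apply/subset_leq_card/fintype.subsetP => j; rewrite !inE => ji.
    by rewrite -val_eqE /= (ltn_eqF ji) /= (leq_ltn_trans (mono _ _ (ltnW ji))).
  apply: contraLR; rewrite -!leqNgt => ki.
  rewrite -[X in (_ <= X)%N](card_below i); apply/subset_leq_card/fintype.subsetP => j.
  rewrite !inE; apply: contraLR; rewrite -!leqNgt => ij.
  exact: leq_trans ki (mono _ _ ij).
by move=> k; rewrite leqNgt !lt_cuts ltnS -leqNgt -eqn_leq eq_sym.
Qed.

(** Sorting the labels. It turns an arbitrary word of labels into one that comes from a gridding. *)
Lemma exists_mono_perm col :
  exists s : 'S_n, {homo col \o s : i j / (i <= j)%N}.
Proof.
pose lo := fun a b : 'I_t => (a <= b)%N.
have lo_total : total lo by move=> a b; exact: leq_total.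
have lo_trans : transitive lo by move=> b a c; exact: leq_trans.
have szt : size (sort lo (codom_tuple (finfun col))) == n.
  by rewrite size_sort size_tuple card_ord.
have : perm_eq (Tuple szt) [tuple col i | i < n].
  rewrite perm_sort; apply/seq.permP => P /=; congr (count P _).
  by rewrite /codom /image_mem; apply: eq_map => i; rewrite ffunE.
move=> /tuple_permP [s es]; exists s => i j ij /=.
have nthE k : nth (col i) (sort lo (codom_tuple (finfun col))) k = 
   nth (col i) [tuple tnth [tuple col i | i < n] (s i) | i < n] k by rewrite -es.
have := sorted_leq_nth lo_trans (fun=> leqnn _) (col i)
  (sort_sorted lo_total (codom_tuple (finfun col))).
move=> /(_ i j); rewrite !inE (eqP szt) !nthE -!tnth_nth !tnth_mktuple.
by apply; rewrite ?ltn_ord.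
Qed.

End MonotoneLabels.

Section GridLabels.
Variables (t u : nat) (M : 'M[perm_set]_(t, u)) (n : nat).

Definition grid_classes (k : 'I_t * 'I_u) : perm_set := pad (M k.1 k.2).

Lemma label_gridded_sub_Grid (col : 'I_n -> 'I_t) (row : 'I_n -> 'I_u) :
  {homo col : i j / (i <= j)%N} -> {homo row : i j / (i <= j)%N} ->
  label_gridded col row grid_classes \subset Grid M n.
Proof.
move=> mc mr; apply/fintype.subsetP => p; rewrite inE => /asboolP pC.
rewrite /Grid inE; apply/asboolP.
exists (cuts col), (cuts row); split; rewrite ?cuts0 ?cutst//.
- by move=> k _; exact: cuts_le.
- by move=> k _; exact: cuts_le.
move=> k l; apply/patt_in_pad; have := pC (k, l); congr patt_in.
by congr map; apply: eq_filter => i; rewrite !cutsP.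
Qed.

End GridLabels.

Section CutLabels.
Context {n t : nat}.
Variable k0 : 'I_t.

(* The default k0 is only used when c does not consist of the cuts of a gridding. *)
Definition cut_label (c : {ffun 'I_t.+1 -> 'I_n.+1}) (i : 'I_n) : 'I_t :=
  odflt k0 [pick k : 'I_t | c (inord k) <= i < c (inord k.+1)]%N.

(** Only the values of [c] at 0 to [t] matter and they are at most [n], so a finite function records
    the dividers. This leaves polynomially many choices in [n]. *)
Lemma exists_cut_label (c : nat -> nat) :
  c 0%N = 0%N -> c t = n -> (forall k, (k < t)%N -> (c k <= c k.+1)%N) ->
  exists c' : {ffun 'I_t.+1 -> 'I_n.+1},
    forall (i : 'I_n) (k : 'I_t), (c k <= i < c k.+1)%N = (cut_label c' i == k).
Proof.
move=> c0 ct mono.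
have mon a b : (a <= b)%N -> (b <= t)%N -> (c a <= c b)%N.
  elim: b => [|b IH]; first by rewrite leqn0 => /eqP ->.
  rewrite leq_eqVlt => /predU1P[-> //|]; rewrite ltnS => ab bt.
  exact: leq_trans (IH ab (ltnW bt)) (mono _ bt).
pose c' := [ffun k : 'I_t.+1 => inord (c k) : 'I_n.+1].
have cE k : (k <= t)%N -> c' (inord k) = c k :> nat.
  by move=> kt; rewrite ffunE !inordK ?ltnS// -ct mon.
exists c' => i k; rewrite /cut_label; case: pickP => [k' |nok].
  rewrite !cE ?(ltn_ord k') ?(ltnW (ltn_ord k'))//= => /andP[k'i ik'].
  apply/andP/eqP => [[ki ik]|<- //]; apply/val_inj => /=.
  case: (ltngtP k' k) => // kk.
    by have := leq_trans ik' (leq_trans (mon _ _ kk (ltnW (ltn_ord k))) ki); rewrite ltnn.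
  by have := leq_trans ik (leq_trans (mon _ _ kk (ltnW (ltn_ord k'))) k'i); rewrite ltnn.
suff [k' ] : exists k' : 'I_t, (c k' <= i < c k'.+1)%N.
  by have := nok k'; rewrite !cE ?(ltn_ord k') ?(ltnW (ltn_ord k'))// => ->.
have : (i < c t)%N by rewrite ct.
have : (t <= t)%N by [].
elim: {1 3}t => [|m IH] mt; first by rewrite c0.
have [ic _|ci im] := ltnP i (c m); first exact: IH (ltnW mt) ic.
by exists (Ordinal mt); rewrite /= ci im.
Qed.

End CutLabels.

(** The grid class is covered by the sets [label_gridded], one for each choice of column and row
    dividers. *)
Lemma card_Grid_le (t u : nat) (k0 : 'I_t) (l0 : 'I_u) (M : 'M[perm_set]_(t, u))
    (n N : nat) :
  (forall (col : 'I_n -> 'I_t) (row : 'I_n -> 'I_u),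
     #|label_gridded col row (grid_classes M)| <= N)%N ->
  (#|Grid M n| <= n.+1 ^ (t.+1 + u.+1) * N)%N.
Proof.
move=> GN; pose J := ({ffun 'I_t.+1 -> 'I_n.+1} * {ffun 'I_u.+1 -> 'I_n.+1})%type.
pose L (cr : J) := label_gridded (cut_label k0 cr.1) (cut_label l0 cr.2) (grid_classes M).
have sub : Grid M n \subset \bigcup_cr L cr.
  apply/fintype.subsetP => p; rewrite /Grid inE => /asboolP [c [r]].
  move=> [[c0 ct] [r0 ru] cm rm cells].
  have [c' c'P] := exists_cut_label k0 c0 ct cm.
  have [r' r'P] := exists_cut_label l0 r0 ru rm.
  apply/finset.bigcupP; exists (c', r') => //; rewrite inE; apply/asboolP => -[k l].
  apply/patt_in_pad; have := cells k l.
  suff -> : cell p c r k l =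
    block (fun i => (cut_label k0 c' i, cut_label l0 r' (p i))) p (k, l) by [].
  by congr map; apply: eq_filter => i; rewrite c'P r'P.
apply: leq_trans (subset_leq_card sub) _.
apply: leq_trans (_ : \sum_cr #|L cr| <= _)%N.
  elim/big_rec2: _ => [|cr A m _ le]; first by rewrite cards0.
  apply: leq_trans (leq_card_setU _ _) _; exact: leq_add.
apply: (@leq_trans (\sum_(cr : J) N)%N); first by apply: leq_sum => cr _; exact: GN.
by rewrite sum_nat_const card_prod !card_ffun !card_ord expnD.
Qed.

(** * Weighted words *)

Section WordWeights.
Context {n : nat} {R : realFieldType}.

Lemma prod_word (K : finType) (x : 'I_n -> K) (F : K -> R) :
  \prod_i F (x i) = \prod_k F k ^+ cnt x k.
Proof.
rewrite (partition_big x predT)//=; apply: eq_bigr => k _.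
rewrite cntE -prodr_const; apply: eq_big => [i|i]; first by rewrite inE.
by move=> /eqP ->.
Qed.

Lemma prod_word_same_cnt (K : finType) (x y : 'I_n -> K) (F : K -> R) :
  same_cnt x y -> \prod_i F (x i) = \prod_i F (y i).
Proof.
by move=> /forallP xy; rewrite !prod_word; apply: eq_bigr => k _; rewrite (eqP (xy k)).
Qed.

Lemma sum_words_prod (K : finType) (F : K -> R) :
  \sum_(x : {ffun 'I_n -> K}) \prod_i F (x i) = (\sum_k F k) ^+ n.
Proof.
rewrite -(bigA_distr_bigA (fun=> F)) -[in RHS](card_ord n).
by rewrite -prodr_const; apply: eq_bigl.
Qed.

Lemma sum_same_cnt_prod (K : finType) (y : 'I_n -> K) (F : K -> R) :
  \sum_(x : {ffun 'I_n -> K} | same_cnt x y) \prod_i F (x i) =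
  #|[set x : {ffun 'I_n -> K} | same_cnt x y]|%:R * \prod_i F (y i).
Proof.
transitivity (\sum_(x : {ffun 'I_n -> K} | same_cnt x y) \prod_i F (y i)).
  by apply: eq_bigr => x; exact: prod_word_same_cnt.
rewrite sumr_const mulr_natl; congr (_ *+ _).
by apply: eq_card => x; rewrite inE.
Qed.

(** The left side is the share of the words with the content of [y] in the expansion of the power on
    the right. *)
Lemma same_cnt_prod_le (K : finType) (y : 'I_n -> K) (F : K -> R) :
  (forall k, 0 <= F k) ->
  #|[set x : {ffun 'I_n -> K} | same_cnt x y]|%:R * \prod_i F (y i) <=
  (\sum_k F k) ^+ n.
Proof.
move=> F0; rewrite -sum_same_cnt_prod -sum_words_prod.
rewrite [leRHS](bigID (fun x : {ffun 'I_n -> K} => same_cnt x y)) /= lerDl.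
by apply: sumr_ge0 => x _; apply: prodr_ge0.
Qed.

(** Pigeonhole: the total weight of all words is split among at most [n.+1 ^ #|K|] contents, and [y]
    has a content of maximal weight. *)
Lemma exists_frequent_word (K : finType) (p : K -> R) :
  (forall k, 0 <= p k) -> 0 < \sum_k p k ->
  exists y : {ffun 'I_n -> K}, (\sum_k p k) ^+ n <= n.+1%:R ^+ #|K| *
    (#|[set x : {ffun 'I_n -> K} | same_cnt x y]|%:R * \prod_i p (y i)).
Proof.
move=> p0 lam0.
pose q (y : {ffun 'I_n -> K}) :=
  #|[set x : {ffun 'I_n -> K} | same_cnt x y]|%:R * \prod_i p (y i).
have q0 y : 0 <= q y by rewrite mulr_ge0// prodr_ge0.
(* Without any word the total weight would be an empty sum, although it is a power of a positive
   number. *)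
have [y0 _|no] := pickP (@predT {ffun 'I_n -> K}); last first.
  have := exprn_gt0 n lam0; rewrite -sum_words_prod big1 ?ltxx// => x.
  by have := no x.
pose y := [arg max_(z > y0) q z]%O.
have qy z : q z <= q y.
  by rewrite /y; case: (@arg_maxP _ _ _ y0 predT q) => // z0 _; apply.
exists y; rewrite -[_ * \prod_i _]/(q y) -sum_words_prod.
pose cf (x : {ffun 'I_n -> K}) : {ffun K -> 'I_n.+1} := [ffun k => inord (cnt x k)].
have cfE x z : (cf x == cf z) = same_cnt x z.
  apply/eqP/forallP => [/ffunP e k|e]; last first.
    by apply/ffunP => k; rewrite !ffunE (eqP (e k)).
  have := e k; rewrite !ffunE => /(congr1 val).
  by rewrite /= !inordK ?ltnS ?cnt_le// => ->.
rewrite (partition_big cf predT)//=.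
apply: (@le_trans _ _ (\sum_(a : {ffun K -> 'I_n.+1}) q y)); last first.
  by rewrite sumr_const card_ffun card_ord -natrX mulr_natl.
apply: ler_sum => a _.
have [z /eqP za|no] := pickP (fun z => cf z == a); last first.
  by rewrite big_pred0 ?q0.
apply: le_trans (qy z); rewrite /q -sum_same_cnt_prod.
rewrite le_eqVlt; apply/orP; left; apply/eqP/eq_bigl => x.
by rewrite -za cfE.
Qed.

(** * Weights on cells and bounds for label-gridded permutations *)

Section Pairs.
Context {T U : finType}.
Implicit Types (F : T * U -> R).

Lemma sum_col_words F (col : 'I_n -> T) :
  \sum_(x in col_words col) \prod_i F (x i) = \prod_i \sum_l F (col i, l).
Proof.
transitivity (\prod_i \sum_(k : T * U | k.1 == col i) F k).
  rewrite (bigA_distr_big_dep (fun i (k : T * U) => k.1 == col i)).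
  apply: eq_bigl => x; rewrite inE; apply/forallP/familyP => h i; have := h i;
    by rewrite /in_mem.
apply: eq_bigr => i _; rewrite (reindex_onto (fun l => (col i, l)) snd) /=.
  by apply: eq_bigl => l; rewrite !eqxx.
by move=> [a b] /= /eqP ->.
Qed.

Lemma sum_row_words F (row : 'I_n -> U) :
  \sum_(y in row_words row) \prod_i F (y i) = \prod_i \sum_k F (k, row i).
Proof.
transitivity (\prod_i \sum_(k : T * U | k.2 == row i) F k).
  rewrite (bigA_distr_big_dep (fun i (k : T * U) => k.2 == row i)).
  apply: eq_bigl => x; rewrite inE; apply/forallP/familyP => h i; have := h i;
    by rewrite /in_mem.
apply: eq_bigr => i _; rewrite (reindex_onto (fun k => (k, row i)) fst) /=.
  by apply: eq_bigl => l; rewrite !eqxx.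
by move=> [a b] /= /eqP ->.
Qed.

Variables (C : T * U -> perm_set) (g : T * U -> R) (v : U -> R) (w : T -> R).
Hypothesis clC : forall k, perm_class (C k).

Lemma card_label_gridded_le (lam b : R) (col : 'I_n -> T) (row : 'I_n -> U) :
  (forall k, 0 <= g k) -> (forall l, 0 < v l) -> (forall k, 0 < w k) ->
  (forall k, \sum_l g (k, l) * v l = w k) ->
  (forall l, \sum_k g (k, l) * w k = lam * v l) ->
  0 <= b -> (forall k m, #|C k m|%:R <= b * g k ^+ (2 * m)) ->
  #|label_gridded col row C|%:R <= b ^+ #|{: T * U}| * lam ^+ n.
Proof.
move=> g0 v0 w0 gv gw b0 Cb.
pose F (k : T * U) := g k * (v k.2 / w k.1).
pose F' (k : T * U) := g k * (v k.2 / w k.1)^-1.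
have q0 (k : T * U) : 0 < v k.2 / w k.1 by rewrite divr_gt0.
have F0 k : 0 <= F k by rewrite mulr_ge0// ltW.
have F'0 k : 0 <= F' k by rewrite mulr_ge0// invr_ge0 ltW.
(* In each column the weights [F] sum to 1, by [gv]; below, the weights [F'] in each row sum to
   [lam], by [gw]. *)
have sumF : \sum_(x in col_words col) \prod_i F (x i) = 1.
  rewrite sum_col_words big1// => i _; rewrite /F /=.
  under eq_bigr do rewrite mulrA; rewrite -mulr_suml gv divff// gt_eqF//.
have sumF' : \sum_(y in row_words row) \prod_i F' (y i) = lam ^+ n.
  rewrite sum_row_words -[in RHS](card_ord n) -prodr_const.
  apply: eq_bigr => i _; rewrite /F' /=.
  under eq_bigr do rewrite invf_div mulrA.
  by rewrite -mulr_suml gw mulfK// gt_eqF.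
have -> : lam ^+ n = \sum_(x in col_words col) \sum_(y in row_words row)
    (\prod_i F (x i) * \prod_i F' (y i)).
  rewrite -sumF' -[LHS]mul1r -[X in X * _]sumF mulr_suml.
  by apply: eq_bigr => x _; rewrite mulr_sumr.
rewrite card_label_gridded// natr_sum mulr_sumr; apply: ler_sum => x _.
rewrite natr_sum mulr_sumr; apply: ler_sum => y _.
(* A pair of words with different contents contributes nothing on the left and a nonnegative weight
   on the right. *)
have [xy|] := boolP (same_cnt x y); last first.
  by rewrite mul0n !mulr_ge0 ?exprn_ge0 ?prodr_ge0.
have -> : \prod_i F (x i) * \prod_i F' (y i) = \prod_k (g k ^+ (2 * cnt x k)).
  rewrite (prod_word_same_cnt _ xy) -big_split /= (eq_bigr (fun i => g (y i) ^+ 2)).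
    rewrite (prod_word y (fun k => g k ^+ 2)); apply: eq_bigr => k _.
    by rewrite -exprM (eqP (forallP xy k)).
  by move=> i _; rewrite /F /F' mulrACA divff ?mulr1// gt_eqF.
rewrite mul1n natr_prod -prodr_const -big_split /=.
by apply: ler_prod => k _; rewrite ler0n /= Cb.
Qed.

(** Keep only the words with the content and columns of [x1], and those with the content and rows of
    [x2]. All of these share one content, so every pair contributes the same product of cardinals,
    bounded below cell by cell. *)
Lemma card_label_gridded_ge (b s : R) (x1 x2 : 'I_n -> T * U) :
  0 <= b -> (forall k m, b * (s * g k) ^+ (2 * m) <= #|C k m|%:R) ->
  (forall k, 0 <= s * g k) -> same_cnt x1 x2 ->
  #|[set x : {ffun 'I_n -> T * U} | same_cnt x x1 &&
       [forall i, (x i).1 == (x1 i).1]]|%:R *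
  #|[set x : {ffun 'I_n -> T * U} | same_cnt x x2 &&
       [forall i, (x i).2 == (x2 i).2]]|%:R *
  (b ^+ #|{: T * U}| * (s ^+ n * \prod_i g (x1 i)) ^+ 2) <=
  #|label_gridded (fst \o x1) (snd \o x2) C|%:R.
Proof.
move=> b0 Cb sg0 x12; set A := [set x | _]; set B := [set x | _].
have trm x y : x \in A -> y \in B -> same_cnt x y.
  rewrite !inE => /andP[/forallP xx1 _] /andP[/forallP yx2 _].
  by apply/forallP => k; rewrite (eqP (xx1 k)) (eqP (forallP x12 k)) eq_sym.
have subA : A \subset col_words (fst \o x1).
  by apply/fintype.subsetP => x; rewrite !inE => /andP[].
have subB : B \subset row_words (snd \o x2).
  by apply/fintype.subsetP => x; rewrite !inE => /andP[].
pose m (x : {ffun 'I_n -> T * U}) := (\prod_k #|C k (cnt x k)|)%N.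
have le1 : (\sum_(x in A) \sum_(y in B) m x <=
    #|label_gridded (fst \o x1) (snd \o x2) C|)%N.
  rewrite card_label_gridded//.
  rewrite [leqRHS](big_setID A) /= (finset.setIidPr subA).
  apply: leq_trans (leq_addr _ _); apply: leq_sum => x xA.
  rewrite [leqRHS](big_setID B) /= (finset.setIidPr subB).
  apply: leq_trans (leq_addr _ _); apply: leq_sum => y yB.
  by rewrite trm// mul1n.
apply: (@le_trans _ _ (\sum_(x in A) \sum_(y in B) m x)%N%:R); last by rewrite ler_nat.
rewrite natr_sum -mulrA mulr_natl -sumr_const; apply: ler_sum => x xA.
rewrite natr_sum mulr_natl -sumr_const; apply: ler_sum => y yB.
move: xA; rewrite inE => /andP[/forallP xx1 _].
rewrite /m natr_prod -[in s ^+ n](card_ord n) -[s ^+ _]prodr_const.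
rewrite -big_split /= (prod_word x1 (fun k => s * g k)) -prodrXl -prodr_const.
rewrite -big_split /=; apply: ler_prod => k _.
rewrite -exprM mulnC mulr_ge0 ?exprn_ge0//=.
by rewrite (eqP (xx1 k)) Cb.
Qed.

(* If x0 has content a, with marginals r and d, the cardinals are n!/a!, r!/a!,
   d!/a!, n!/r! and n!/d! in this order. *)
Lemma sqr_card_words (x0 x1 x2 : 'I_n -> T * U) :
  same_cnt x1 x0 -> same_cnt x2 x0 ->
  same_cnt (fst \o x1) (fst \o x0) -> same_cnt (snd \o x2) (snd \o x0) ->
  (#|[set x : {ffun 'I_n -> T * U} | same_cnt x x0]| ^ 2 =
  (#|[set x : {ffun 'I_n -> T * U} | same_cnt x x1 &&
       [forall i, (x i).1 == (x1 i).1]]| *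
  #|[set x : {ffun 'I_n -> T * U} | same_cnt x x2 &&
       [forall i, (x i).2 == (x2 i).2]]|) *
  (#|[set x : {ffun 'I_n -> T} | same_cnt x (fst \o x0)]| *
  #|[set x : {ffun 'I_n -> U} | same_cnt x (snd \o x0)]|))%N.
Proof.
move=> /forallP x10 /forallP x20 /forallP f10 /forallP s20.
have := card_words_over fst x1; have := card_words_over snd x2.
have := card_words (fst \o x0); have := card_words (snd \o x0).
have := card_words x0.
under [X in _ -> _ -> _ -> _ -> (_ * X)%N = _ -> _]eq_bigr do rewrite (eqP (x10 _)).
under [X in _ -> _ -> _ -> (_ * X)%N = _ -> _]eq_bigr do rewrite (eqP (x20 _)).
under [X in _ -> _ -> _ -> _ = X -> _]eq_bigr do rewrite (eqP (s20 _)).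
under [X in _ -> _ -> _ -> _ -> _ = X -> _]eq_bigr do rewrite (eqP (f10 _)).
set A := (\prod_k (cnt x0 k)`!)%N; set X := #|_|.
set Xd := #|_|; set D := (\prod_k _)%N; set Xr := #|_|; set S := (\prod_k _)%N.
move=> XA XD XS; set Ng := #|_| => gA; set Nf := #|_| => fA.
have A0 : (0 < A)%N by apply: prodn_gt0 => k; exact: fact_gt0.
apply/eqP; rewrite -(eqn_pmul2r (_ : 0 < A ^ 2)%N) ?expn_gt0 ?A0//; apply/eqP.
rewrite -expnMn XA; transitivity ((Xr * S) * (Xd * D))%N.
  by rewrite XS XD.
by rewrite -gA -fA; ring.
Qed.

(** A content frequent for the weights [g * w * v] is chosen. It is unchanged by rearranging the
    word, so [p] and [q] stay free, and can later sort the column and row labels. *)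
Lemma exists_label_gridded_ge (b s lam : R) :
  (forall k, 0 <= g k) -> (forall l, 0 <= v l) -> (forall k, 0 <= w k) ->
  0 < lam -> \sum_k g k * w k.1 * v k.2 = lam ->
  \sum_k w k ^+ 2 = lam -> \sum_l v l ^+ 2 = 1 ->
  0 <= b -> 0 <= s -> (forall k m, b * (s * g k) ^+ (2 * m) <= #|C k m|%:R) ->
  exists x : {ffun 'I_n -> T * U}, forall p q : 'S_n,
    b ^+ #|{: T * U}| * (s ^+ 2 * lam) ^+ n <=
    n.+1%:R ^+ (2 * #|{: T * U}|) *
      #|label_gridded (fun i => (x (p i)).1) (fun j => (x (q j)).2) C|%:R.
Proof.
move=> g0 v0 w0 lam0 gwv ww vv b0 s0 Cb.
have h0 k : 0 <= g k * w k.1 * v k.2 by rewrite !mulr_ge0.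
have [|x] := @exists_frequent_word _ _ h0; first by rewrite gwv.
rewrite gwv => freq; exists x => p q.
have same_perm (K : finType) (y : 'I_n -> K) (r : 'S_n) : same_cnt (fun i => y (r i)) y.
  by apply/forallP => k; apply/eqP/(@eq_cnt_perm _ _ _ _ r).
have x12 : same_cnt (fun i => x (p i)) (fun i => x (q i)).
  apply/forallP => k; have /forallP/(_ k)/eqP -> := same_perm _ x p.
  by have /forallP/(_ k)/eqP -> := same_perm _ x q.
apply: le_trans (ler_wpM2l (exprn_ge0 _ (ler0n _ _))
  (card_label_gridded_ge b0 Cb (fun k => mulr_ge0 s0 (g0 k)) x12)).
have := @sqr_card_words x _ _ (same_perm _ x p) (same_perm _ x q)
  (same_perm _ (fst \o x) p) (same_perm _ (snd \o x) q).
move: freq; rewrite (prod_word_same_cnt g (same_perm _ x p)).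
have := @same_cnt_prod_le _ (fst \o x) (fun k => w k ^+ 2) (fun k => sqr_ge0 _).
have := @same_cnt_prod_le _ (snd \o x) (fun k => v k ^+ 2) (fun k => sqr_ge0 _).
rewrite ww vv !prodrXl !big_split /= expr1n.
set Xd := #|_|; set V := \prod_i _; set Xr := #|_|; set W := \prod_i _.
set X := #|[set _ | _]|; set G := \prod_i _; set P := n.+1%:R ^+ _.
set Nf := #|_|; set Ng := #|_| => Vle Wle freq /(congr1 (fun k => k%:R : R)).
rewrite natrX !natrM => XX.
have L0 : 0 < lam ^+ n by rewrite exprn_gt0.
(* Square the frequency bound and split [X ^ 2] by [sqr_card_words]: the factor [Xr * W ^ 2] is at
   most [lam ^ n] and [Xd * V ^ 2] at most 1, so one factor [lam ^ n] cancels. *)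
have main : lam ^+ n <= P ^+ 2 * (Nf%:R * Ng%:R * G ^+ 2).
  rewrite -(ler_pM2r L0).
  apply: (@le_trans _ _ ((P * (X%:R * (G * W * V))) ^+ 2)).
    rewrite -expr2 ler_pXn2r// ?nnegrE ?(ltW L0)//; exact: le_trans (ltW L0) freq.
  have -> : (P * (X%:R * (G * W * V))) ^+ 2 = P ^+ 2 * (Nf%:R * Ng%:R * G ^+ 2) *
      ((Xr%:R * W ^+ 2) * (Xd%:R * V ^+ 2)).
    by rewrite !exprMn XX; ring.
  apply: ler_wpM2l; first by do ![exact: sqr_ge0|exact: ler0n|apply: mulr_ge0].
  rewrite -[leRHS]mulr1.
  by apply: ler_pM => //; do ![exact: sqr_ge0|exact: ler0n|apply: mulr_ge0].
have -> : n.+1%:R ^+ (2 * #|{: T * U}|) = P ^+ 2 by rewrite mulnC exprM.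
rewrite [X in _ <= X](_ : _ = b ^+ #|{: T * U}| * (s ^+ 2) ^+ n *
    (P ^+ 2 * (Nf%:R * Ng%:R * G ^+ 2))); last first.
  by rewrite exprMn -!exprM (mulnC 2%N); ring.
rewrite [in leLHS]exprMn [leLHS]mulrA; apply: ler_wpM2l => //.
by apply: mulr_ge0; [exact: exprn_ge0|apply/exprn_ge0/sqr_ge0].
Qed.

End Pairs.
End WordWeights.

(** * The largest singular value *)

Lemma continuous_sumr (R : realType) (T : topologicalType) (I : finType)
    (F : I -> T -> R) :
  (forall i, continuous (F i)) -> continuous (fun x => \sum_i F i x).
Proof.
move=> cF; apply: continuous_big => [|i _]; last exact: cF.
exact: (@pseudometric_normed_Zmodule.add_continuous R R).
Qed.

Section LargestSingularValue.
Context {R : realType} {t u : nat}.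
Implicit Types (G : 'M[R]_(t, u)) (x y : 'rV[R]_u).

Definition sqn (m : nat) (z : 'rV[R]_m) : R := \sum_i z 0 i ^+ 2.

Definition app G x : 'rV[R]_t := \row_k \sum_l G k l * x 0 l.

Lemma sqn_ge0 m (z : 'rV[R]_m) : 0 <= sqn z.
Proof. by apply: sumr_ge0 => i _; exact: sqr_ge0. Qed.

Lemma sqn_eq0 m (z : 'rV[R]_m) : sqn z = 0 -> z = 0.
Proof.
move=> /eqP; rewrite psumr_eq0 => [/allP z0|i _]; last exact: sqr_ge0.
apply/rowP => i; rewrite mxE; apply/eqP; rewrite -sqrf_eq0.
by apply: z0; rewrite mem_index_enum.
Qed.

Lemma sqnZ m a (z : 'rV[R]_m) : sqn (a *: z) = a ^+ 2 * sqn z.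
Proof. by rewrite /sqn mulr_sumr; apply: eq_bigr => i _; rewrite mxE exprMn. Qed.

Lemma sqnDZ m s (y z : 'rV[R]_m) :
  sqn (y + s *: z) = sqn y + s * (2 * \sum_i y 0 i * z 0 i) + s ^+ 2 * sqn z.
Proof.
rewrite /sqn !mulr_sumr -!big_split /=; apply: eq_bigr => i _.
by rewrite !mxE; ring.
Qed.

Lemma appZ G a x : app G (a *: x) = a *: app G x.
Proof.
apply/rowP => k; rewrite !mxE mulr_sumr; apply: eq_bigr => l _.
by rewrite mxE mulrCA.
Qed.

Lemma appD G x y : app G (x + y) = app G x + app G y.
Proof.
apply/rowP => k; rewrite !mxE -big_split /=; apply: eq_bigr => l _.
by rewrite mxE mulrDr.
Qed.

Lemma app_mulmx G x : app G x = x *m G^T.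
Proof.
by apply/rowP => k; rewrite !mxE; apply: eq_bigr => l _; rewrite mxE mulrC.
Qed.

Lemma continuous_sqn_app G : continuous (fun x => sqn (app G x)).
Proof.
apply: continuous_sumr => k x.
have -> : (fun x => app G x 0 k ^+ 2) =
    (fun a : R => a ^+ 2) \o (fun x => \sum_l G k l * x 0 l).
  by apply/funext => z /=; rewrite mxE.
apply: continuous_comp; last exact: exprn_continuous.
apply: continuous_sumr => l z.
by apply: continuousM; [exact: cst_continuous|exact: coord_continuous].
Qed.

Lemma continuous_sqn : continuous (@sqn u).
Proof.
apply: continuous_sumr => l x.
exact: (continuous_comp (@coord_continuous _ _ _ _ _ x) (@exprn_continuous _ _ _)).
Qed.

(** A closed subset of the cube with sides [[-1, 1]]. *)
Lemma sphere_compact : compact [set x : 'rV[R]_u | sqn x = 1]%classic.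
Proof.
apply: (subclosed_compact _ (rV_compact (fun _ : 'I_u => @segment_compact R (-1) 1))).
  by move/continuous_closedP: continuous_sqn => /(_ _ (@closed_eq R 1)).
move=> x /= x1 i; rewrite in_itv /= -ler_norml -(ler_pXn2r (ltn0Sn 1)) ?nnegrE//.
rewrite expr1n real_normK ?num_real// -x1 /sqn (bigD1 i)//= lerDl.
by apply: sumr_ge0 => j _; exact: sqr_ge0.
Qed.

(** Maximise [sqn (app G x)] on the unit sphere. As [G] is nonnegative, taking absolute values of
    the coordinates does not decrease the maximum; homogeneity extends the bound to all [x]. *)
Lemma exists_top_vector G : (0 < u)%N -> (forall k l, 0 <= G k l) ->
  exists v : 'rV[R]_u, [/\ forall l, 0 <= v 0 l, sqn v = 1 &
    forall x, sqn (app G x) <= sqn (app G v) * sqn x].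
Proof.
move=> u0 G0.
have [|c /set_mem c1 cmax] := @EVT_max_rV R u (fun x => sqn (app G x)) _ _ sphere_compact
  (continuous_subspaceT (@continuous_sqn_app G)).
  exists (delta_mx 0 (Ordinal u0)); rewrite /= /sqn (bigD1 (Ordinal u0))//= mxE !eqxx.
  by rewrite big1 ?addr0 ?expr1n// => i /negPf i0; rewrite mxE i0 andbF expr0n.
pose v : 'rV[R]_u := \row_l `|c 0 l|.
exists v; split=> [l||x].
- by rewrite mxE.
- by rewrite -c1; apply: eq_bigr => l _; rewrite mxE real_normK ?num_real.
have cv : sqn (app G c) <= sqn (app G v).
  apply: ler_sum => k _; rewrite !mxE -[leLHS]real_normK ?num_real//.
  rewrite ler_pXn2r ?nnegrE//; last first.
    by apply: sumr_ge0 => l _; rewrite mxE mulr_ge0.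
  apply: (le_trans (ler_norm_sum _ _ _)); apply: ler_sum => l _.
  by rewrite mxE normrM ger0_norm.
have [x0|x0] := eqVneq (sqn x) 0.
  rewrite x0 mulr0 (sqn_eq0 x0) -(scale0r (0 : 'rV[R]_u)) appZ sqnZ.
  by rewrite expr0n mul0r.
have sx : 0 < sqn x by rewrite lt_neqAle eq_sym x0 sqn_ge0.
pose s := Num.sqrt (sqn x); have s2 : s ^+ 2 = sqn x by rewrite sqr_sqrtr// ltW.
have s0 : s != 0 by rewrite -sqrf_eq0 s2.
have [y xy] : exists y, x = s *: y by exists (s^-1 *: x); rewrite scalerA divff// scale1r.
have e1 : sqn y = 1.
  by apply: (mulfI (_ : s ^+ 2 != 0)); rewrite ?sqrf_eq0// -sqnZ -xy s2 mulr1.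
rewrite xy appZ !sqnZ e1 mulr1 mulrC ler_wpM2r ?sqr_ge0//.
by apply: le_trans cv; apply: cmax; rewrite inE.
Qed.

Lemma linear_term_eq0 (a b : R) :
  (forall s, 0 <= s * a + s ^+ 2 * b) -> a = 0.
Proof.
move=> h; apply/eqP; rewrite -sqrf_eq0 eq_le sqr_ge0 andbT.
have b1 : 0 < 1 + `|b| by rewrite ltr_pwDl.
(* At this [s] the expression is at most [- a ^ 2 / (1 + |b|) ^ 2], since [b - |b| <= 0]. *)
have := h (- a / (1 + `|b|)).
have -> : - a / (1 + `|b|) * a + (- a / (1 + `|b|)) ^+ 2 * b =
   a ^+ 2 * (b - (1 + `|b|)) / (1 + `|b|) ^+ 2.
  by field; rewrite gt_eqF.
rewrite pmulr_lge0 ?invr_gt0 ?exprn_gt0//; have := ler_norm b; have := sqr_ge0 a.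
set A := a ^+ 2; set B := `|b|; move=> A0 bB; rewrite mulrBr => H; nra.
Qed.

(** The quadratic form [lam * sqn x - sqn (app G x)] is nonnegative and vanishes at [v], so its
    derivative there is zero; the direction of the [l]-th basis vector gives coordinate [l]. *)
Lemma top_vector_eigen G v : sqn v = 1 ->
  (forall x, sqn (app G x) <= sqn (app G v) * sqn x) ->
  forall l, \sum_k G k l * app G v 0 k = sqn (app G v) * v 0 l.
Proof.
move=> v1 vmax l; set lam := sqn (app G v).
pose x : 'rV[R]_u := delta_mx 0 l.
have appx k : app G x 0 k = G k l.
  rewrite mxE (bigD1 l)//= mxE !eqxx mulr1 big1 ?addr0// => j /negPf jl.
  by rewrite mxE jl andbF mulr0.
have dotx : \sum_i v 0 i * x 0 i = v 0 l.
  rewrite (bigD1 l)//= mxE !eqxx mulr1 big1 ?addr0// => j /negPf jl.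
  by rewrite mxE jl andbF mulr0.
have := @linear_term_eq0 (lam * (2 * v 0 l) - 2 * \sum_k G k l * app G v 0 k)
  (lam * sqn x - sqn (app G x)).
have -> : \sum_k G k l * app G v 0 k = \sum_k app G v 0 k * app G x 0 k.
  by apply: eq_bigr => k _; rewrite appx mulrC.
move=> h; have e : lam * (2 * v 0 l) - 2 * \sum_k app G v 0 k * app G x 0 k = 0.
  apply: h => s; have := vmax (v + s *: x).
  rewrite appD appZ !sqnDZ dotx v1 -/lam; set S := \sum_k _; lra.
move: e; set S := \sum_k _; lra.
Qed.

Lemma greatest_eigenvalue_top G v : (0 < t)%N ->
  sqn v = 1 -> (forall x, sqn (app G x) <= sqn (app G v) * sqn x) ->
  greatest_eigenvalue (G^T *m G) (sqn (app G v)) /\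
  greatest_eigenvalue (G *m G^T) (sqn (app G v)).
Proof.
move=> t0 v1 vmax; set lam := sqn (app G v).
have lam0 : 0 <= lam by exact: sqn_ge0.
have eigv : v *m (G^T *m G) = lam *: v.
  rewrite mulmxA -app_mulmx; apply/rowP => l.
  rewrite [LHS]mxE [RHS]mxE -top_vector_eigen//.
  by apply: eq_bigr => k _; rewrite mulrC.
have le_lam x b : x *m (G^T *m G) = b *: x -> x != 0 -> b <= lam.
  move=> xb x0; have sx : 0 < sqn x.
    by rewrite lt_neqAle sqn_ge0 andbT eq_sym; apply: contra_neq x0; exact: sqn_eq0.
  rewrite -(ler_pM2r sx); apply: le_trans (vmax x).
  have sqnE m (z : 'rV[R]_m) : sqn z = (z *m z^T) 0 0.
    by rewrite mxE; apply: eq_bigr => i _; rewrite mxE expr2.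
  rewrite !sqnE app_mulmx trmx_mul trmxK mulmxA -(mulmxA x) xb.
  by rewrite -scalemxAl [leRHS]mxE.
have v0 : v != 0.
  by apply/eqP => v0; move: v1; rewrite v0 /sqn big1 => [/eqP|i _];
    rewrite ?mxE ?expr0n//= eq_sym oner_eq0.
split; split.
- by apply/eigenvalueP; exists v.
- by move=> b /eigenvalueP[x]; exact: le_lam.
(* If [lam] is 0 then [app G v] is zero and no eigenvector, but [G] vanishes, so any nonzero vector
   serves. *)
- apply/eigenvalueP; have [l0|l0] := eqVneq lam 0.
    exists (delta_mx 0 (Ordinal t0)).
      have G0 : G = 0.
        apply/matrixP => k l; have := vmax (delta_mx 0 l); rewrite -/lam l0 mul0r.
        move=> le0; have /sqn_eq0/rowP/(_ k) : sqn (app G (delta_mx 0 l)) = 0.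
          by apply/eqP; rewrite eq_le le0 sqn_ge0.
        rewrite !mxE (bigD1 l)//= mxE !eqxx mulr1 big1 ?addr0// => j /negPf jl.
        by rewrite mxE jl andbF mulr0.
      by rewrite G0 mul0mx mulmx0 l0 scale0r.
    by apply/eqP => /rowP/(_ (Ordinal t0)); rewrite !mxE !eqxx => /eqP; rewrite oner_eq0.
  exists (app G v).
    by rewrite app_mulmx mulmxA -(mulmxA v) eigv -scalemxAl.
  by apply: contra_neq l0 => e; rewrite /lam e /sqn big1// => i _; rewrite mxE expr0n.
(* Either [y *m G] is zero and [b] is 0, or it is an eigenvector of [G^T *m G] for [b]. *)
- move=> b /eigenvalueP[y yb y0]; have [yG|yG] := eqVneq (y *m G) 0.
    move: yb; rewrite mulmxA yG mul0mx => /esym/eqP; rewrite scaler_eq0 (negPf y0) orbF.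
    by move=> /eqP ->.
  apply: le_lam yG; by rewrite mulmxA -(mulmxA y) yb -scalemxAl.
Qed.

End LargestSingularValue.

(** * Exponential growth *)

Section ExponentialGrowth.
Context {R : realType}.

Lemma bernoulli_ge (h : R) (n : nat) : 0 <= h -> 1 + n%:R * h <= (1 + h) ^+ n.
Proof.
move=> h0; elim: n => [|n IH]; first by rewrite mul0r addr0.
rewrite exprS -natr1; apply: le_trans (ler_wpM2l _ IH); last by rewrite addr_ge0.
have : 0 <= n%:R * h * h by rewrite !mulr_ge0.
by nra.
Qed.

(** Induction on [d]. With [(1 + e) ^ 2 <= 1 + h], one factor [(1 + e) ^ n] bounds the power of
    degree [d] and the other, by Bernoulli, the extra [n.+1]. *)
Lemma poly_le_exp (d : nat) (h : R) : 0 < h ->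
  exists2 B : R, 0 < B & forall n : nat, n.+1%:R ^+ d <= B * (1 + h) ^+ n.
Proof.
elim: d h => [|d IH] h h0.
  by exists 1 => // n; rewrite expr0 mul1r exprn_ege1// lerDl ltW.
pose e := h / (2 + h); have e0 : 0 < e by rewrite divr_gt0// addr_gt0.
have [B B0 HB] := IH _ e0.
exists (B * (1 + e^-1)); first by rewrite mulr_gt0// addr_gt0// invr_gt0.
move=> n; rewrite exprSr.
have eh : (1 + e) ^+ 2 <= 1 + h.
  have -> : 1 + h = (1 + e) ^+ 2 + h ^+ 2 * (1 + h) / (2 + h) ^+ 2.
    by rewrite /e; field; rewrite gt_eqF// addr_gt0.
  by rewrite lerDl divr_ge0 ?mulr_ge0 ?sqr_ge0 ?addr_ge0// ltW.
have n1 : n.+1%:R <= (1 + e^-1) * (1 + e) ^+ n.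
  apply: le_trans (ler_wpM2l _ (bernoulli_ge n (ltW e0))); last first.
    by rewrite addr_ge0// invr_ge0 ltW.
  have -> : (1 + e^-1) * (1 + n%:R * e) = 1 + n%:R * e + e^-1 + n%:R.
    by field; rewrite gt_eqF.
  have : 0 < e^-1 by rewrite invr_gt0.
  have : 0 <= n%:R * e by rewrite mulr_ge0// ltW.
  rewrite -natr1; lra.
have -> : B * (1 + e^-1) * (1 + h) ^+ n = B * ((1 + e^-1) * (1 + h) ^+ n) by rewrite mulrA.
apply: le_trans (ler_pM (exprn_ge0 d (ler0n R _)) (ler0n R _) (HB n) n1) _.
rewrite mulrACA -[leLHS]mulrA ler_pM2l//; apply: ler_wpM2l.
  by rewrite addr_ge0// invr_ge0 ltW.
by rewrite -exprMn -expr2 lerXn2r// ?nnegrE ?sqr_ge0// addr_ge0// ltW.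
Qed.

Lemma poly_exp_near_le (A : R) (d : nat) (r s : R) : 0 <= r -> r < s ->
  (\forall n \near \oo, (A * n.+1%:R ^+ d * r ^+ n <= s ^+ n)%R)%classic.
Proof.
move=> r0 rs.
(* Chosen so that [s = (1 + h) * r + h]; the denominator is [r + 1] because [r] may be 0. *)
pose h := (s - r) / (r + 1).
have r1 : 0 < r + 1 by rewrite ltr_wpDl.
have h0 : 0 < h by rewrite divr_gt0// subr_gt0.
(* One degree more than needed: the spare factor [n.+1] absorbs the constant [|A| * B]. *)
have [B B0 HB] := poly_le_exp d.+1 h0.
have hs : (1 + h) * r <= s.
  have -> : s = (1 + h) * r + h by rewrite /h; field; rewrite gt_eqF.
  by rewrite lerDl ltW.
near=> n.
have nA : `|A| * B <= n.+1%:R.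
  apply: (@le_trans _ _ n%:R); last by rewrite ler_nat.
  by near: n; exact: nbhs_infty_ger.
apply: (@le_trans _ _ (((1 + h) * r) ^+ n)); last first.
  by rewrite lerXn2r// ?nnegrE ?mulr_ge0 ?addr_ge0 ?(ltW h0)//;
    exact: ltW (le_lt_trans r0 rs).
rewrite exprMn ler_wpM2r ?exprn_ge0//.
apply: (@le_trans _ _ (`|A| * n.+1%:R ^+ d)).
  by rewrite ler_wpM2r ?exprn_ge0// ler_norm.
rewrite -(ler_pM2r (ltr0Sn R n)) -mulrA -exprSr.
apply: le_trans (ler_wpM2l (normr_ge0 _) (HB n)) _.
by rewrite mulrA [leRHS]mulrC ler_wpM2r// exprn_ge0// addr_ge0// ltW.
Unshelve. all: by end_near. Qed.

Lemma powR_natV_le (x s : R) (n : nat) : 0 <= x -> 0 <= s -> (0 < n)%N ->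
  (x `^ n%:R^-1 <= s) = (x <= s ^+ n).
Proof.
move=> x0 s0 n0; have nV : 0 <= (n%:R^-1 : R) by rewrite invr_ge0.
have nn : n%:R * n%:R^-1 = 1 :> R by rewrite divff// pnatr_eq0 -lt0n.
apply/idP/idP => h.
  have -> : x = (x `^ n%:R^-1) ^+ n.
    by rewrite -powR_mulrn ?powR_ge0// -powRrM mulrC nn powRr1.
  by rewrite lerXn2r ?nnegrE ?powR_ge0.
have -> : s = (s ^+ n) `^ n%:R^-1.
  by rewrite -powR_mulrn// -powRrM nn powRr1.
by apply: ge0_ler_powR; rewrite ?nnegrE ?exprn_ge0.
Qed.

Lemma powR_natV_ge (x s : R) (n : nat) : 0 <= x -> 0 <= s -> (0 < n)%N ->
  (s <= x `^ n%:R^-1) = (s ^+ n <= x).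
Proof.
move=> x0 s0 n0; have nV : 0 <= (n%:R^-1 : R) by rewrite invr_ge0.
have nn : n%:R * n%:R^-1 = 1 :> R by rewrite divff// pnatr_eq0 -lt0n.
apply/idP/idP => h.
  have -> : x = (x `^ n%:R^-1) ^+ n.
    by rewrite -powR_mulrn ?powR_ge0// -powRrM mulrC nn powRr1.
  by rewrite lerXn2r ?nnegrE ?powR_ge0.
have -> : s = (s ^+ n) `^ n%:R^-1.
  by rewrite -powR_mulrn// -powRrM nn powRr1.
by apply: ge0_ler_powR; rewrite ?nnegrE ?exprn_ge0.
Qed.

(** Polynomial factors disappear under [n]-th roots, by [poly_exp_near_le]; a lower bound
    [lam - e <= 0] is automatic. *)
Lemma cvg_growth_seq (C : perm_set) (lam : R) : 0 <= lam ->
  (forall s, lam < s -> exists (A : R) (d : nat) (r : R),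
     [/\ 0 <= r, r < s & forall n, #|C n|%:R <= A * n.+1%:R ^+ d * r ^+ n]) ->
  (forall s, 0 <= s -> s < lam -> exists (A : R) (d : nat) (r : R),
     [/\ s < r & forall n, r ^+ n <= A * n.+1%:R ^+ d * #|C n|%:R]) ->
  (growth_seq R C @ \oo --> lam)%classic.
Proof.
move=> lam0 up lo; apply/cvgrPdist_le => e e0.
have [A [d [r [r0 rs Hup]]]] := up (lam + e) (ltac:(by rewrite ltrDl)).
have lo_near : (\forall n \near \oo,
    lam - e <= 0 \/ ((lam - e) ^+ n <= #|C n|%:R)%R)%classic.
  have [le0|gt0] := leP (lam - e) 0; first by apply: nearW => n; left.
  have [|A' [d' [r' [rs' Hlo]]]] := lo _ (ltW gt0); first by rewrite gtrBl.
  have := @poly_exp_near_le (`|A'| + 1) d' (lam - e) r' (ltW gt0) rs'.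
  apply: filterS => n h; right.
  (* [|A'| + 1] replaces [A'] so that the factor can be cancelled. *)
  have A1 : 0 < (`|A'| + 1) * n.+1%:R ^+ d' by rewrite mulr_gt0 ?exprn_gt0// ltr_wpDl.
  rewrite -(ler_pM2l A1); apply: le_trans h _; apply: le_trans (Hlo n) _.
  rewrite ler_wpM2r// ler_wpM2r ?exprn_ge0//.
  by rewrite (le_trans (ler_norm _))// lerDl.
have up_near := @poly_exp_near_le A d r (lam + e) r0 rs.
near=> n.
have n0 : (0 < n)%N by near: n; exact: nbhs_infty_gt.
have upn : A * n.+1%:R ^+ d * r ^+ n <= (lam + e) ^+ n by near: n; exact: up_near.
have lon : lam - e <= 0 \/ (lam - e) ^+ n <= #|C n|%:R by near: n; exact: lo_near.
have lower : lam - e <= growth_seq R C n.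
  have [le0|gt0] := leP (lam - e) 0; first exact: le_trans le0 (powR_ge0 _ _).
  case: lon => [|le]; first by rewrite leNgt gt0.
  by rewrite /growth_seq powR_natV_ge// ltW.
have upper : growth_seq R C n <= lam + e.
  rewrite /growth_seq powR_natV_le ?addr_ge0 ?(ltW e0)//.
  exact: le_trans (Hup n) upn.
by rewrite ler_norml; apply/andP; split; lra.
Unshelve. all: by end_near. Qed.

Lemma near_infty_nat (P : nat -> Prop) :
  (\forall n \near \oo, P n)%classic -> exists N, forall n, (N <= n)%N -> P n.
Proof. by case=> N _ h; exists N => n Nn; exact: h. Qed.

Lemma gr_ge0 (C : perm_set) : has_growth_rate R C -> 0 <= gr R C.
Proof.
by move=> cC; apply: limr_ge => //; apply: nearW => n; exact: powR_ge0.
Qed.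

(** Beyond some [N] the bound holds with constant 1; the sum in [b] covers the finitely many earlier
    lengths. *)
Lemma card_le_growth (C : perm_set) (s : R) : has_growth_rate R C -> gr R C < s ->
  exists2 b : R, 0 <= b & forall m, #|C m|%:R <= b * s ^+ m.
Proof.
move=> cC gs; have s0 : 0 < s by exact: le_lt_trans (gr_ge0 cC) gs.
have [N HN] : exists N, forall m, (N <= m)%N -> growth_seq R C m <= s.
  apply: near_infty_nat; move/cvgrPdist_lt: cC => /(_ (s - gr R C)).
  rewrite subr_gt0 => /(_ gs); apply: filterS => m; rewrite distrC.
  by move=> /ltr_normlW; rewrite ltrBlDr subrK => /ltW.
have b0 : 0 <= \sum_(i < N.+1) #|C i|%:R / s ^+ i.
  by apply: sumr_ge0 => i _; rewrite divr_ge0// exprn_ge0// ltW.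
exists (1 + \sum_(i < N.+1) #|C i|%:R / s ^+ i); first by rewrite addr_ge0.
move=> m; have [mN|mN] := ltnP m N.+1.
  rewrite -ler_pdivrMr ?exprn_gt0// (bigD1 (Ordinal mN))//= addrCA lerDl.
  by rewrite addr_ge0// sumr_ge0// => i _; rewrite divr_ge0// exprn_ge0// ltW.
have := HN m (ltnW mN); rewrite /growth_seq powR_natV_le ?(ltW s0)//; last first.
  exact: leq_ltn_trans mN.
by move=> h; apply: le_trans h _; rewrite ler_peMl ?exprn_ge0 ?(ltW s0)// lerDl.
Qed.

(** The pattern of the first [m] entries of a member, obtained as the component [true] of its [glue]
    decomposition for the label [i < m]. *)
Lemma card_gt0_downward (C : perm_set) (m n : nat) : perm_class C -> (m <= n)%N ->
  (0 < #|C n|)%N -> (0 < #|C m|)%N.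
Proof.
move=> clC mn /card_gt0P [p pC].
pose al (i : 'I_n) : bool := (i < m)%N.
pose be (j : 'I_n) : bool := al (p^-1%g j).
have pl i : be (p i) = al i by rewrite /be permK.
have [s ps] := exists_glue (eq_cnt_perm pl) pl.
have -> : m = cnt al true.
  have -> : m = size (iota 0 m) by rewrite size_iota.
  rewrite /cnt -(size_map val).
  have -> : map val (occ al true) = [seq j <- iota 0 n | (j < m)%N].
    by rewrite -val_enum_ord filter_map; congr map;
      apply: eq_filter => i /=; rewrite eqb_id.
  rewrite size_filter -(subnKC mn) iotaD count_cat add0n.
  rewrite -[LHS]addn0; congr (_ + _)%N.
    by apply/esym/eqP; rewrite -all_count; apply/allP => j; rewrite mem_iota add0n.
  apply/esym/eqP; rewrite eqn0Ngt -has_count; apply/hasPn => j.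
  by rewrite mem_iota -leqNgt => /andP[].
apply/card_gt0P; exists (s true); apply: clC pC.
exists (block al p true); last by rewrite ps; exact: block_glue.
exact/map_subseq/filter_subseq.
Qed.

(** Large lengths follow from convergence. For small ones the padded class is nonempty by downward
    closure, and [b = (1 + s) ^ -(N + 1)] brings the left side below 1. For [s = 0] only length 0
    matters, where [pad] supplies a member. *)
Lemma growth_le_card (C : perm_set) (s : R) : perm_class C -> has_growth_rate R C ->
  0 <= s -> s < gr R C \/ s = 0 ->
  exists2 b : R, 0 < b & forall m, b * s ^+ m <= #|pad C m|%:R.
Proof.
move=> clC cC s_ge0 sg; have pad_gt0 m : m = 0%N -> #|pad C m|%:R = 1 :> R.
  by move=> ->; rewrite /pad eqxx cardsT card_Sn.
have [->|s_neq0] := eqVneq s 0.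
  exists 1 => // -[|m]; last by rewrite expr0n/= mulr0.
  by rewrite expr0 mulr1 pad_gt0.
have s0 : 0 < s by rewrite lt_neqAle eq_sym s_neq0.
case: sg => [sg|/eqP]; last by rewrite (negPf s_neq0).
have [N HN] : exists N, forall m, (N <= m)%N -> s <= growth_seq R C m.
  apply: near_infty_nat; move/cvgrPdist_lt: cC => /(_ (gr R C - s)).
  rewrite subr_gt0 => /(_ sg); apply: filterS => m.
  move=> /ltr_normlW; rewrite -/(gr R C); set y := growth_seq R C m; lra.
have sm m : (N < m)%N -> s ^+ m <= #|C m|%:R.
  move=> Nm; have := HN m (ltnW Nm).
  by rewrite /growth_seq powR_natV_ge//; exact: leq_ltn_trans Nm.
have s1 : 1 <= 1 + s by rewrite lerDl.
have b0 : 0 < (1 + s) ^+ N.+1 by rewrite exprn_gt0// (lt_le_trans _ s1).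
exists ((1 + s) ^+ N.+1)^-1 => [|m]; first by rewrite invr_gt0.
rewrite mulrC ler_pdivrMr//; have [mN|Nm] := leqP m N; last first.
  have m0 : m != 0%N by rewrite -lt0n (leq_ltn_trans _ Nm).
  apply: le_trans (sm _ Nm) _; rewrite /pad (negPf m0) ler_peMr//.
  exact: exprn_ege1.
have pad1 : 1 <= #|pad C m|%:R :> R.
  have [m0|m0] := eqVneq m 0%N; first by rewrite pad_gt0.
  rewrite ler1n /pad (negPf m0); apply: card_gt0_downward clC (leqW mN) _.
  by rewrite -(ltr0n R); apply: lt_le_trans (sm _ (ltnSn N)); exact: exprn_gt0.
apply: (@le_trans _ _ ((1 + s) ^+ N.+1)); last by rewrite ler_peMl// ltW.
apply: (@le_trans _ _ ((1 + s) ^+ m)).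
  by rewrite lerXn2r// ?nnegrE ?addr_ge0// lerDr.
by rewrite ler_weXn2l// leqW.
Qed.

End ExponentialGrowth.

(** * Growth of grid classes *)

Section Perturbation.
Context {R : realType} {t u : nat}.

(** Adding [e] to every entry makes the matrix positive, hence its top vector and the image of that
    vector too, while the top eigenvalue exceeds [lam] by at most [e * K]. *)
Lemma exists_perturbed_vector (G : 'M[R]_(t, u)) (lam s : R) :
  (0 < t)%N -> (0 < u)%N -> (forall k l, 0 <= G k l) ->
  (forall x, sqn (app G x) <= lam * sqn x) -> lam < s ->
  exists (e lam' : R) (v : 'I_u -> R) (w : 'I_t -> R),
    [/\ 0 < e, 0 <= lam' /\ lam' < s, (forall l, 0 < v l) /\ (forall k, 0 < w k),
      forall k, \sum_l (G k l + e) * v l = w k &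
      forall l, \sum_k (G k l + e) * w k = lam' * v l].
Proof.
move=> t0 u0 G0 lamP lams.
pose S := \sum_k \sum_l G k l.
have S0 : 0 <= S by rewrite sumr_ge0// => k _; rewrite sumr_ge0.
(* Each of the [t] coordinates of the image is [a + e * sg] with [a <= S], [sg <= u] and [e <= 1],
   so its square exceeds [a ^ 2] by at most [e * (2 * S * u + u ^ 2)]. *)
pose K := t%:R * (2 * S * u%:R + u%:R ^+ 2).
have K0 : 0 <= K by rewrite mulr_ge0// addr_ge0 ?sqr_ge0// !mulr_ge0.
have d0 : 0 < s - lam by rewrite subr_gt0.
have D0 : 0 < K + 1 + (s - lam) by lra.
(* Ensures both [e <= 1] and [e * K < s - lam]. *)
pose e := (s - lam) / (K + 1 + (s - lam)).
have e0 : 0 < e by rewrite divr_gt0.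
have e1 : e <= 1 by rewrite ler_pdivrMr// mul1r; lra.
have eK : e * K < s - lam.
  by rewrite -mulrA -subr_gt0 -[X in _ < X - _]mulr1 -mulrBr mulr_gt0// subr_gt0
    mulrC ltr_pdivrMr// mul1r; lra.
pose Ge : 'M[R]_(t, u) := \matrix_(k, l) (G k l + e).
have Ge0 k l : 0 < Ge k l by rewrite mxE ltr_wpDl.
have [v [v0 v1 vmax]] := exists_top_vector u0 (fun k l => ltW (Ge0 k l)).
have eig := top_vector_eigen v1 vmax; set lam' := sqn (app Ge v) in vmax eig.
have [l0 vl0] : exists l0, 0 < v 0 l0.
  apply/not_existsP => h; move: v1; rewrite /sqn big1 => [/eqP|l _].
    by rewrite eq_sym oner_eq0.
  have := h l => /negP; rewrite -leNgt => vl.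
  have -> : v 0 l = 0 by apply/le_anti; rewrite vl v0.
  by rewrite expr0n.
have w0 k : 0 < app Ge v 0 k.
  rewrite mxE (bigD1 l0)//= ltr_pwDl ?mulr_gt0//.
  by apply: sumr_ge0 => l _; rewrite mulr_ge0// ltW.
have lamv l : 0 < lam' * v 0 l.
  rewrite -eig (bigD1 (Ordinal t0))//= ltr_pwDl ?mulr_gt0//.
  by apply: sumr_ge0 => k _; rewrite mulr_ge0// ltW.
have lam'0 : 0 <= lam' by exact: sqn_ge0.
have vpos l : 0 < v 0 l.
  rewrite lt_neqAle v0 andbT eq_sym; apply/eqP => vl.
  by have := lamv l; rewrite vl mulr0 ltxx.
exists e, lam', (v 0), (app Ge v 0); split=> //.
- split=> //; apply: (@le_lt_trans _ _ (lam + e * K)); last by lra.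
  have vle1 l : v 0 l <= 1.
    rewrite -(ler_pXn2r (ltn0Sn 1)) ?nnegrE// expr1n -v1 /sqn (bigD1 l)//= lerDl.
    by apply: sumr_ge0 => j _; exact: sqr_ge0.
  pose sg := \sum_l v 0 l.
  have sg0 : 0 <= sg by apply: sumr_ge0.
  have sgu : sg <= u%:R.
    by rewrite -[u in leRHS]card_ord -sumr_const; apply: ler_sum.
  have appE k : app Ge v 0 k = app G v 0 k + e * sg.
    rewrite !mxE /sg mulr_sumr -big_split /=; apply: eq_bigr => l _.
    by rewrite mxE mulrDl.
  have a0 k : 0 <= app G v 0 k.
    by rewrite mxE; apply: sumr_ge0 => l _; rewrite mulr_ge0.
  have aS k : app G v 0 k <= S.
    rewrite mxE /S (bigD1 k)//= -[leLHS]addr0 lerD//.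
      by apply: ler_sum => l _; rewrite ler_piMr.
    by apply: sumr_ge0 => j _; exact: sumr_ge0.
  apply: (@le_trans _ _ (\sum_k (app G v 0 k ^+ 2 + e * (2 * S * u%:R + u%:R ^+ 2)))).
    apply: ler_sum => k _; rewrite appE sqrrD -addrA lerD2l.
    have h1 : app G v 0 k * sg <= S * u%:R by exact: ler_pM.
    have h2 : sg ^+ 2 <= u%:R ^+ 2 by rewrite lerXn2r ?nnegrE.
    have h3 : e * (e * sg ^+ 2) <= e * (u%:R ^+ 2).
      by rewrite ler_pM2l//; apply: le_trans h2; rewrite ler_piMl ?sqr_ge0.
    have h4 : e * (app G v 0 k * sg) <= e * (S * u%:R) by rewrite ler_pM2l.
    by rewrite -mulr_natl; nra.
  rewrite big_split /= sumr_const card_ord.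
  have := lamP v; rewrite v1 mulr1 /sqn => h.
  by rewrite lerD// /K -[_ *+ t]mulr_natl mulrCA.
- by move=> k; rewrite mxE; apply: eq_bigr => l _; rewrite [Ge _ _]mxE.
- by move=> l; rewrite -eig; apply: eq_bigr => k _; rewrite [Ge _ _]mxE.
Qed.

End Perturbation.

Section GridBounds.
Context {R : realType} {t u : nat}.
Variable M : 'M[perm_set]_(t, u).
Hypothesis classM : forall (k : 'I_t) (l : 'I_u), perm_class (M k l).
Hypothesis growthM : forall (k : 'I_t) (l : 'I_u), has_growth_rate R (M k l).

Let G : 'M[R]_(t, u) := growth_matrix R M.

Lemma growth_matrix_ge0 k l : 0 <= G k l.
Proof. by rewrite mxE sqrtr_ge0. Qed.

Lemma sqr_growth_matrix k l : G k l ^+ 2 = gr R (M k l).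
Proof. by rewrite mxE sqr_sqrtr// gr_ge0. Qed.

Lemma grid_classes_class k : perm_class (grid_classes M k).
Proof. exact/perm_class_pad/classM. Qed.

Lemma card_Grid_upper (lam s : R) : (0 < t)%N -> (0 < u)%N ->
  (forall x, sqn (app G x) <= lam * sqn x) -> lam < s ->
  exists (A : R) (d : nat) (r : R),
    [/\ 0 <= r, r < s & forall n, #|Grid M n|%:R <= A * n.+1%:R ^+ d * r ^+ n].
Proof.
move=> t0 u0 lamP lams.
have [e [r [v [w [e0 [r0 rs] [v0 w0] gv gw]]]]] :=
  exists_perturbed_vector t0 u0 growth_matrix_ge0 lamP lams.
pose g (k : 'I_t * 'I_u) := G k.1 k.2 + e.
have g0 k : 0 <= g k by rewrite addr_ge0 ?growth_matrix_ge0// ltW.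
have /fin_all_exists2 [b b0 Hb] (k : 'I_t * 'I_u) :
    exists2 b : R, 0 <= b & forall m, #|M k.1 k.2 m|%:R <= b * (g k ^+ 2) ^+ m.
  apply: card_le_growth => //; rewrite -sqr_growth_matrix.
  by rewrite ltr_pXn2r ?nnegrE ?growth_matrix_ge0// ltrDl.
(* A common constant for all cells; the summand 1 accounts for the padding at length 0. *)
pose B := 1 + \sum_k b k.
have sb0 : 0 <= \sum_k b k by exact: sumr_ge0.
have B0 : 0 <= B by rewrite addr_ge0.
have HB k m : #|grid_classes M k m|%:R <= B * g k ^+ (2 * m).
  rewrite exprM /grid_classes /pad; case: (eqVneq m 0%N) => [->|_].
    by rewrite cardsT card_Sn expr0 mulr1 lerDl.
  apply: le_trans (Hb k m) _; rewrite ler_wpM2r ?exprn_ge0 ?sqr_ge0//.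
  rewrite /B (bigD1 k)//= addrCA lerDl addr_ge0//; exact: sumr_ge0.
exists (B ^+ #|{: 'I_t * 'I_u}|), (t.+1 + u.+1)%N, r; split=> // n.
pose X := B ^+ #|{: 'I_t * 'I_u}| * r ^+ n.
have X0 : 0 <= X by rewrite mulr_ge0 ?exprn_ge0.
(* [card_Grid_le] takes a natural bound, so the real bound [X] is truncated. *)
have := @card_Grid_le t u (Ordinal t0) (Ordinal u0) M n (Num.truncn X).
rewrite -(ler_nat R) => h; apply: le_trans (h _) _ => [col row|].
  rewrite truncn_ge_nat//.
  exact: (card_label_gridded_le grid_classes_class col row g0 v0 w0 gv gw B0 HB).
rewrite natrM natrX [leRHS]mulrAC [leRHS]mulrC ler_wpM2l ?exprn_ge0//.
by rewrite -truncn_ge_nat.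
Qed.

Lemma card_Grid_lower (v : 'rV[R]_u) (s : R) :
  (forall l, 0 <= v 0 l) -> sqn v = 1 -> 0 <= s -> s < sqn (app G v) ->
  exists (A : R) (d : nat) (r : R),
    [/\ s < r & forall n, r ^+ n <= A * n.+1%:R ^+ d * #|Grid M n|%:R].
Proof.
set lam := sqn (app G v) => v0 v1 s0 slam.
have lam0 : 0 < lam by exact: le_lt_trans s0 slam.
pose r := (s + lam) / 2; have sr : s < r by rewrite /r; lra.
have rlam : r < lam by rewrite /r; lra.
(* With [sg ^ 2 = q < 1], the squares of the scaled entries [sg * g k] lie strictly below the growth
   rates, or are 0 with them, and [sg ^ 2 * lam] is still [r > s]. *)
pose q := r / lam; have q0 : 0 <= q by rewrite divr_ge0 ?(ltW lam0)// (le_trans s0)// ltW.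
have q1 : q < 1 by rewrite ltr_pdivrMr// mul1r.
pose sg := Num.sqrt q; have sg2 : sg ^+ 2 = q by rewrite sqr_sqrtr.
pose g (k : 'I_t * 'I_u) := G k.1 k.2.
have /fin_all_exists2 [b b0 Hb] (k : 'I_t * 'I_u) :
    exists2 b : R, 0 < b & forall m,
      b * ((sg * g k) ^+ 2) ^+ m <= #|grid_classes M k m|%:R.
  apply: growth_le_card; rewrite ?sqr_ge0//; rewrite exprMn sg2 sqr_growth_matrix.
  have [g0|g0] := eqVneq (gr R (M k.1 k.2)) 0; first by right; rewrite g0 mulr0.
  by left; rewrite gtr_pMl// lt_neqAle eq_sym g0 gr_ge0.
(* A positive number below every [b k]. *)
pose B := (1 + \sum_k (b k)^-1)^-1.
have sb0 : 0 < 1 + \sum_k (b k)^-1.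
  by rewrite ltr_pwDl// sumr_ge0// => k _; rewrite invr_ge0 ltW.
have B0 : 0 < B by rewrite invr_gt0.
have HB k m : B * (sg * g k) ^+ (2 * m) <= #|grid_classes M k m|%:R.
  apply: le_trans (Hb k m); rewrite exprM; apply: ler_wpM2r.
    exact/exprn_ge0/sqr_ge0.
  rewrite /B -[leRHS]invrK lef_pV2 ?posrE ?invr_gt0//.
  rewrite (bigD1 k)//= addrCA lerDl addr_ge0// sumr_ge0// => j _.
  by rewrite invr_ge0 ltW.
pose w k := app G v 0 k.
have w0 k : 0 <= w k.
  by rewrite /w mxE; apply: sumr_ge0 => l _; rewrite mulr_ge0 ?growth_matrix_ge0.
have gwv : \sum_k g k * w k.1 * v 0 k.2 = lam.
  rewrite -(pair_big xpredT xpredT (fun k l => G k l * w k * v 0 l)) /=.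
  apply: eq_bigr => k _; have wE : w k = \sum_l G k l * v 0 l by rewrite /w mxE.
  rewrite expr2 -/(w k) [X in _ = X * _]wE mulr_suml.
  by apply: eq_bigr => l _; rewrite mulrAC.
exists ((B ^+ #|{: 'I_t * 'I_u}|)^-1), (2 * #|{: 'I_t * 'I_u}|)%N, r.
split=> // n.
have [x Hx] := @exists_label_gridded_ge n R _ _ (grid_classes M) g (v 0) w
  grid_classes_class B sg lam (fun k => growth_matrix_ge0 k.1 k.2) v0 w0 lam0 gwv
  (erefl _) v1 (ltW B0) (sqrtr_ge0 _) HB.
(* Sorting the columns of the positions and the rows of the values makes the label-gridded
   permutations members of the grid class. *)
have [p mp] := exists_mono_perm (fun i => (x i).1).
have [p' mp'] := exists_mono_perm (fun j => (x j).2).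
have := Hx p p'; rewrite sg2 divfK ?gt_eqF// => h.
rewrite -mulrA [leRHS]mulrC ler_pdivlMr ?exprn_gt0// mulrC.
apply: le_trans h _; rewrite ler_wpM2l ?exprn_ge0// ler_nat subset_leq_card//.
exact: label_gridded_sub_Grid.
Qed.

End GridBounds.

Theorem theorem1p1 (R : realType) (t u : nat) (t_gt0 : (0 < t)%N)
    (u_gt0 : (0 < u)%N) (M : 'M[perm_set]_(t, u))
    (classM : forall (k : 'I_t) (l : 'I_u), perm_class (M k l))
    (growthM : forall (k : 'I_t) (l : 'I_u), has_growth_rate R (M k l)) :
  let Gamma : 'M[R]_(t, u) := growth_matrix R M in
  [/\ has_growth_rate R (Grid M),
      greatest_eigenvalue (Gamma^T *m Gamma) (gr R (Grid M))
    & greatest_eigenvalue (Gamma *m Gamma^T) (gr R (Grid M))].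
Proof.
move=> Gamma.
have [v [v0 v1 vmax]] := exists_top_vector u_gt0 (@growth_matrix_ge0 R t u M).
have [top1 top2] := greatest_eigenvalue_top t_gt0 v1 vmax.
(* The same [v] serves twice: its maximality gives the upper bound, its nonnegativity and unit norm
   the lower one. *)
have cvg_Grid : (growth_seq R (Grid M) @ \oo --> sqn (app Gamma v))%classic.
  apply: cvg_growth_seq => [|s|s]; first exact: sqn_ge0.
    exact: card_Grid_upper.
  exact: card_Grid_lower.
have grE : gr R (Grid M) = sqn (app Gamma v) by apply: cvg_lim cvg_Grid; exact: Rhausdorff.
by rewrite grE; split=> //; exact: cvgP cvg_Grid.
Qed.
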